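(* Let $k$ be an algebraically closed field of characteristic $0$, let $m,d$ be natural numbers (positive integers) such that $(1+m)d$ is even, and let $\xi\in k$ be a primitive $2m$-th root of $1$. Then, as a Hopf algebra, $D(m,d,\xi)$ is not isomorphic to any of the following Hopf algebras: $k[x]$ (with $x$ primitive); $k[x^{\pm1}]$ (with $x$ group-like); the group algebra $k\mathbb{D}$ of the infinite dihedral group; any infinite dimensional Taft algebra $H(n,t,\eta)$; any generalized Liu algebra $B(n,\omega',\gamma')$.
   Context: $\mathbb{D}=\langle g,x\mid g^2=1,\ gxg=x^{-1}\rangle$. Taft algebras: for integers $n>1$, $0\le t\le n-1$ and $\eta$ a primitive $n$-th root of $1$, $H(n,t,\eta)$ is generated by $x,g$ with relations $g^n=1$, $xg=\eta gx$, and with $\Delta(g)=g\otimes g$, $\epsilon(g)=1$, $\Delta(x)=x\otimes g^t+1\otimes x$, $\epsilon(x)=0$, $S(g)=g^{-1}$, $S(x)=-xg^{-t}$. Generalized Liu algebras: for positive integers $n,\omega'$ and $\gamma'$ a primitive $n$-th root of $1$, $B(n,\omega',\gamma')$ is generated by $x^{\pm1},g,y$ with relations $xx^{-1}=x^{-1}x=1$, $xg=gx$, $xy=yx$, $yg=\gamma' gy$, $y^n=1-x^{\omega'}=1-g^n$, and with $\Delta(x)=x\otimes x$, $\Delta(g)=g\otimes g$, $\Delta(y)=y\otimes g+1\otimes y$, $\epsilon(x)=\epsilon(g)=1$, $\epsilon(y)=0$, $S(x)=x^{-1}$, $S(g)=g^{-1}$, $S(y)=-yg^{-1}$. Definition of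 $D(m,d,\xi)$. Put $\omega:=md$, $\gamma:=\xi^2$, and $\phi_i:=1-\gamma^{-i-1}x^d$ for $i\in\mathbb{Z}$. As a $k$-algebra it is generated by $x^{\pm1},g^{\pm1},y,u_0,\dots,u_{m-1}$ with relations (indices of $u$ are read modulo $m$) $$xx^{-1}=x^{-1}x=1,\quad gg^{-1}=g^{-1}g=1,\quad xg=gx,\quad xy=yx,\quad yg=\gamma gy,\quad y^m=1-x^\omega=1-g^m,$$ $$xu_i=u_ix^{-1},\quad yu_i=\phi_iu_{i+1}=\xi x^du_iy,\quad u_ig=\gamma^ix^{-2d}gu_i,$$ and, for $0\le i,j\le m-1$, $u_iu_j=(-1)^{-j}\xi^{-j}\gamma^{\frac{j(j+1)}{2}}\frac1m x^{-\frac{1+m}{2}d}\,P_{ij}\,g$, where $P_{ij}=\phi_i\phi_{i+1}\cdots\phi_{m-2-j}\,y^{i+j}$ if $i+j\le m-2$; $P_{ij}=y^{i+j}$ if $i+j=m-1$; and $P_{ij}=\phi_i\cdots\phi_{m-1}\phi_0\cdots\phi_{m-2-j}\,y^{i+j-m}$ otherwise (where $\phi_0\cdots\phi_{m-2-j}$ is the empty product $1$ if $j=m-1$). It is a Hopf algebra with $\Delta(x)=x\otimes x$, $\Delta(g)=g\otimes g$, $\Delta(y)=y\otimes g+1\otimes y$, $\Delta(u_i)=\sum_{j=0}^{m-1}\gamma^{j(i-j)}u_j\otimes x^{-jd}g^ju_{i-j}$; $\epsilon(x)=\epsilon(g)=\epsilon(u_0)=1$, $\epsilon(y)=\epsilon(u_s)=0$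 for $1\le s\le m-1$; $S(x)=x^{-1}$, $S(g)=g^{-1}$, $S(y)=-yg^{-1}$, $S(u_i)=(-1)^i\xi^{-i}\gamma^{-\frac{i(i+1)}{2}}x^{id+\frac32(1-m)d}g^{m-i-1}u_i$ for $0\le i\le m-1$.
   Formalization: The non-isomorphism with the group algebra of the infinite dihedral group is stated only for m > 1, because for m = 1 one has g = x^d, y = 1 - x^d, u_0^2 = 1, and D(1,d,-1) is that group algebra; the other comparisons are stated for all m ≥ 1. *)

(* Defs.v *)
From HB Require Import structures.
From mathcomp Require Import all_boot all_order all_algebra.
From mathcomp Require Import generic_quotient ring_quotient finmap boolp.
From mathcomp.multinomials Require Import monalg.

Set Implicit Arguments.
Unset Strict Implicit.
Unset Printing Implicit Defensive.

Import GRing.Theory.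
Local Open Scope ring_scope.
Local Open Scope quotient_scope.

(* tlift f is the linear map v *t w |-> f v w when f is bilinear (tlift_tens,
   tlift_is_linear), and depends on the choice of representatives otherwise. *)

Definition mlift (k : fieldType) (K : choiceType) (V : lmodType k)
    (f : K -> V) (a : {malg k[K]}) : V :=
  \sum_(x <- msupp a) a@_x *: f x.

Section MLift.
Context (k : fieldType) (K : choiceType) (V : lmodType k) (f : K -> V).
Implicit Type a : {malg k[K]}.

Lemma mliftEw a (d : {fset K}) : (msupp a `<=` d)%fset ->
  mlift f a = \sum_(x <- d) a@_x *: f x.
Proof.
move=> le; rewrite /mlift [LHS](big_fset_incl _ le) => //= x _ /mcoeff_outdom ->.
by rewrite scale0r.
Qed.

Lemma mlift_is_linear : linear (mlift f).
Proof.
move=> c a b; pose d := (msupp a `|` msupp b)%fset.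
have sa : (msupp a `<=` d)%fset by apply: fsubsetUl.
have sb : (msupp b `<=` d)%fset by apply: fsubsetUr.
have sab : (msupp (c *: a + b) `<=` d)%fset.
  apply: (fsubset_trans (msuppD_le _ _)).
  by rewrite fsetSU //; apply: msuppZ_le.
rewrite (mliftEw sa) (mliftEw sb) (mliftEw sab) scaler_sumr -big_split /=.
by apply: eq_bigr => x _; rewrite mcoeffD mcoeffZ scalerDl scalerA.
Qed.

HB.instance Definition _ :=
  GRing.isLinear.Build k {malg k[K]} V *:%R (mlift f) mlift_is_linear.

Lemma mliftU x : mlift f << x >> = f x.
Proof. by rewrite (mliftEw msuppU_le) big_seq_fset1 mcoeffUU scale1r. Qed.

End MLift.

Section Tensor.
Context (k : fieldType) (V W : lmodType k).
Local Notation F := {malg k[(V * W)%type]}.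
Local Notation "<( v , w )>" := (<< (v, w) >> : F).

(* tensor V W is the free vector space on V * W modulo bilin_span. *)
Inductive bilin_span : F -> Prop :=
| BilinL (c : k) v v' w :
    bilin_span (<(c *: v + v', w)> - (c *: <(v, w)> + <(v', w)>))
| BilinR (c : k) v w w' :
    bilin_span (<(v, c *: w + w')> - (c *: <(v, w)> + <(v, w')>))
| Bilin0 : bilin_span 0
| BilinC (c : k) s t : bilin_span s -> bilin_span t -> bilin_span (c *: s + t).

Definition bilin_pred : {pred F} := fun s => `[< bilin_span s >].

Lemma bilin_pred_zmod : zmod_closed bilin_pred.
Proof.
split=> [|s t /asboolP Is /asboolP It]; first exact/asboolP/Bilin0.
by apply/asboolP; rewrite addrC -scaleN1r; apply: BilinC.
Qed.

HB.instance Definition _ := GRing.isZmodClosed.Build F bilin_pred bilin_pred_zmod.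

Definition tensor : Type := {ideal_quot bilin_pred}.
HB.instance Definition _ := GRing.Zmodule.on tensor.

Definition tpi (s : F) : tensor := \pi_{ideal_quot bilin_pred} s.
Definition trepr (t : tensor) : F := repr (t : {ideal_quot bilin_pred}).

Lemma treprK : cancel trepr tpi. Proof. exact: reprK. Qed.

Lemma tpiP s t : tpi s = tpi t <-> bilin_span (s - t).
Proof.
split=> [/eqP|Ist]; last by apply/eqP; rewrite -Quotient.idealrBE; apply/asboolP.
by rewrite -Quotient.idealrBE => /asboolP.
Qed.

Lemma tpiD s t : tpi (s + t) = tpi s + tpi t.
Proof. exact: (raddfD \pi_{ideal_quot bilin_pred}). Qed.

Definition tscale (c : k) (t : tensor) : tensor := tpi (c *: trepr t).

Lemma tpiZ c s : tpi (c *: s) = tscale c (tpi s).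
Proof.
apply/tpiP; rewrite -scalerBr -[_ *: _]addr0; apply: BilinC; last exact: Bilin0.
by apply/tpiP; rewrite treprK.
Qed.

Lemma tscaleA c c' t : tscale c (tscale c' t) = tscale (c * c') t.
Proof. by rewrite -(treprK t) -!tpiZ scalerA. Qed.
Lemma tscale1 : left_id 1 tscale.
Proof. by move=> t; rewrite -(treprK t) -!tpiZ scale1r. Qed.
Lemma tscaleDr : right_distributive tscale +%R.
Proof.
move=> c s t; rewrite -(treprK s) -(treprK t).
by rewrite -tpiD -!tpiZ -tpiD scalerDr.
Qed.
Lemma tscaleDl t : {morph tscale^~ t : c c' / c + c'}.
Proof. by move=> c c'; rewrite -(treprK t) -!tpiZ -tpiD scalerDl. Qed.

HB.instance Definition _ := GRing.Zmodule_isLmodule.Build k tensor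
  tscaleA tscale1 tscaleDr tscaleDl.

Definition tens (v : V) (w : W) : tensor := tpi <(v, w)>.

Definition tlift (U : lmodType k) (f : V -> W -> U) (t : tensor) : U :=
  mlift (fun p => f p.1 p.2) (trepr t).

Section TLift.
Context (U : lmodType k) (f : V -> W -> U).
Hypothesis f_linl : forall w, linear (f^~ w).
Hypothesis f_linr : forall v, linear (f v).

Lemma tlift_tpi s : tlift f (tpi s) = mlift (fun p => f p.1 p.2) s.
Proof.
have gI a : bilin_span a -> mlift (fun p => f p.1 p.2) a = 0.
  elim=> [c v v' w|c v w w'||c a' b _ a0 _ b0].
  - by rewrite linearB linearP /= !mliftU /= f_linl subrr.
  - by rewrite linearB linearP /= !mliftU /= f_linr subrr.
  - by rewrite linear0.
  - by rewrite linearP /= a0 b0 scaler0 addr0.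
apply/eqP; rewrite -subr_eq0 -linearB /= gI //.
by apply/tpiP; rewrite treprK.
Qed.

Lemma tlift_tens v w : tlift f (tens v w) = f v w.
Proof. by rewrite tlift_tpi mliftU. Qed.

Lemma tlift_is_linear : linear (tlift f).
Proof.
move=> c s t; rewrite -(treprK s) -(treprK t) -[c *: _]tpiZ -tpiD !tlift_tpi.
exact: mlift_is_linear.
Qed.

End TLift.

Lemma tens_linl w : linear (tens^~ w).
Proof.
move=> c v v'; rewrite /tens -[_ *: tpi _]tpiZ -tpiD; apply/tpiP; exact: BilinL.
Qed.

Lemma tens_linr v : linear (tens v).
Proof.
move=> c w w'; rewrite /tens -[_ *: tpi _]tpiZ -tpiD; apply/tpiP; exact: BilinR.
Qed.

End Tensor.

Notation "v *t w" := (tens v w) (at level 45, no associativity) : ring_scope.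

Section TensorMaps.
Context (k : fieldType).

Definition tmap (V W V' W' : lmodType k) (f : V -> V') (g : W -> W')
    (t : tensor V W) : tensor V' W' :=
  tlift (fun v w => f v *t g w) t.

Definition tassoc (U V W : lmodType k) (t : tensor (tensor U V) W) :
    tensor U (tensor V W) :=
  tlift (fun s w => tlift (fun u v => u *t (v *t w)) s) t.

Definition tmul (A B : algType k) (s t : tensor A B) : tensor A B :=
  tlift (fun a b => tlift (fun a' b' => (a * a') *t (b * b')) t) s.

End TensorMaps.

HB.mixin Record Algebra_isHopf (k : fieldType) H of GRing.Algebra k H := {
  comul : H -> tensor H H;
  counit : H -> k;
  antipode : H -> H;
  comul_is_linear : linear comul;
  comul1 : comul 1 = 1 *t 1;
  comulM : forall a b, comul (a * b) = tmul (comul a) (comul b);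
  counit_is_scalar : scalar counit;
  counit1 : counit 1 = 1;
  counitM : {morph counit : a b / a * b};
  antipode_is_linear : linear antipode;
  comulA : forall a,
    tassoc (tmap comul idfun (comul a)) = tmap idfun comul (comul a);
  counitl : forall a, tlift (fun b c => counit b *: c) (comul a) = a;
  counitr : forall a, tlift (fun b c => counit c *: b) (comul a) = a;
  antipodel : forall a,
    tlift (fun b c => antipode b * c) (comul a) = (counit a)%:A;
  antipoder : forall a,
    tlift (fun b c => b * antipode c) (comul a) = (counit a)%:A
}.

#[short(type="hopfAlgType")]
HB.structure Definition HopfAlgebra (k : fieldType) :=
  { H of Algebra_isHopf k H & GRing.Algebra k H }.

(* A Hopf algebra named by generators and relations is determined up to
   isomorphism only; the predicates is_... below say that H is one of its models,
   the structure maps being determined by their values on the generators. *)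

Definition hopf_iso (k : fieldType) (H K : hopfAlgType k) : Prop :=
  exists f : {lrmorphism H -> K},
    [/\ bijective f,
        forall a, comul (f a) = tmap f f (comul a),
        forall a, counit (f a) = counit a
      & forall a, antipode (f a) = f (antipode a)].

Section HopfElements.
Context (k : fieldType) (H : hopfAlgType k).
Implicit Type x : H.

Definition inverses (x x' : H) : Prop := x * x' = 1 /\ x' * x = 1.

Definition is_grouplike x : Prop :=
  [/\ comul x = x *t x, counit x = 1 & inverses x (antipode x)].

Definition is_primitive x : Prop :=
  [/\ comul x = x *t 1 + 1 *t x, counit x = 0 & antipode x = - x].

End HopfElements.

(* presents R e: the family e generates A, with R as defining relations, that is,
   A is the quotient of the free algebra by the two-sided ideal generated by the
   a - b with R a b. *)

Section Presentations.
Context (k : fieldType) (I : choiceType).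
Local Notation F := {malg k[{fmonom I}]}.

Definition fgen (i : I) : F := << fmu i >>.

Definition eval_monom (A : algType k) (e : I -> A) (w : {fmonom I}) : A :=
  \prod_(i <- w) e i.

Definition eval (A : algType k) (e : I -> A) (a : F) : A :=
  mmap (in_alg A) (eval_monom e) a.

Inductive rel_ideal (R : F -> F -> Prop) : F -> Prop :=
| RelIdeal_gen (a b c d : F) : R a b -> rel_ideal R (c * (a - b) * d)
| RelIdeal_0 : rel_ideal R 0
| RelIdeal_D (a b : F) : rel_ideal R a -> rel_ideal R b -> rel_ideal R (a + b).

Definition presents (R : F -> F -> Prop) (A : algType k) (e : I -> A) : Prop :=
  (forall a, exists s, eval e s = a) /\
  (forall s, eval e s = 0 <-> rel_ideal R s).

End Presentations.

Section GroupPresentations.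
Context (I : Type).

(* The letter (i, b) stands for the generator i if b = false, and for its
   inverse if b = true. *)
Definition letter : Type := (I * bool)%type.

Definition weval (G : groupType) (e : I -> G) (w : seq letter) : G :=
  (\prod_(l <- w) if l.2 then (e l.1)^-1 else e l.1)%g.

Inductive word_equiv (R : seq letter -> seq letter -> Prop) :
    seq letter -> seq letter -> Prop :=
| WordEquiv_refl w : word_equiv R w w
| WordEquiv_sym w w' : word_equiv R w w' -> word_equiv R w' w
| WordEquiv_trans w w' w'' :
    word_equiv R w w' -> word_equiv R w' w'' -> word_equiv R w w''
| WordEquiv_cancel u v i b :
    word_equiv R (u ++ [:: (i, b); (i, ~~ b)] ++ v) (u ++ v)
| WordEquiv_rel u v r s : R r s -> word_equiv R (u ++ r ++ v) (u ++ s ++ v).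

Definition presents_group (R : seq letter -> seq letter -> Prop)
    (G : groupType) (e : I -> G) : Prop :=
  (forall x, exists w, weval e w = x) /\
  (forall w w', weval e w = weval e w' <-> word_equiv R w w').

End GroupPresentations.

Inductive dihedral_gen := Dih_g | Dih_x.

Inductive dihedral_rel :
    seq (letter dihedral_gen) -> seq (letter dihedral_gen) -> Prop :=
| Dih_gg : dihedral_rel [:: (Dih_g, false); (Dih_g, false)] [::]
| Dih_gxg : dihedral_rel
    [:: (Dih_g, false); (Dih_x, false); (Dih_g, false)] [:: (Dih_x, true)].

Definition is_infinite_dihedral (G : groupType) : Prop :=
  exists e : dihedral_gen -> G, presents_group dihedral_rel e.

Definition is_group_algebra (k : fieldType) (G : groupType)
    (H : hopfAlgType k) : Prop :=
  exists e : G -> H,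
    [/\ bijective (mlift e : {malg k[G]} -> H),
        e 1%g = 1,
        forall x y, e (x * y)%g = e x * e y
      & forall x, [/\ comul (e x) = e x *t e x, counit (e x) = 1
                   & antipode (e x) = e (x^-1)%g]].

Definition is_polynomial_hopf (k : fieldType) (H : hopfAlgType k) : Prop :=
  exists f : {lrmorphism {poly k} -> H}, bijective f /\ is_primitive (f 'X).

Inductive laurent_gen := Lau_x | Lau_xV.

Definition laurent_code (s : laurent_gen) := if s is Lau_x then true else false.
Definition laurent_decode (b : bool) := if b then Lau_x else Lau_xV.
Lemma laurent_codeK : cancel laurent_code laurent_decode. Proof. by case. Qed.
HB.instance Definition _ := Choice.copy laurent_gen (can_type laurent_codeK).

Inductive laurent_rel (k : fieldType) (A : lalgType k) (e : laurent_gen -> A) :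
    A -> A -> Prop :=
| Lau_xxV : laurent_rel e (e Lau_x * e Lau_xV) 1
| Lau_xVx : laurent_rel e (e Lau_xV * e Lau_x) 1.

Definition is_laurent_hopf (k : fieldType) (H : hopfAlgType k) : Prop :=
  exists e : laurent_gen -> H,
    presents (laurent_rel (@fgen k laurent_gen)) e /\ is_grouplike (e Lau_x).

Inductive taft_gen := Taft_x | Taft_g.

Definition taft_code (s : taft_gen) := if s is Taft_x then true else false.
Definition taft_decode (b : bool) := if b then Taft_x else Taft_g.
Lemma taft_codeK : cancel taft_code taft_decode. Proof. by case. Qed.
HB.instance Definition _ := Choice.copy taft_gen (can_type taft_codeK).

Inductive taft_rel (k : fieldType) (n : nat) (eta : k) (A : lalgType k)
    (e : taft_gen -> A) : A -> A -> Prop :=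
| Taft_gn : taft_rel n eta e (e Taft_g ^+ n) 1
| Taft_xg : taft_rel n eta e (e Taft_x * e Taft_g) (eta *: (e Taft_g * e Taft_x)).

Definition is_taft (k : fieldType) (n t : nat) (eta : k) (H : hopfAlgType k) :
    Prop :=
  exists e : taft_gen -> H, let x := e Taft_x in let g := e Taft_g in
    [/\ presents (taft_rel n eta (@fgen k taft_gen)) e,
        is_grouplike g,
        comul x = x *t g ^+ t + 1 *t x,
        counit x = 0
      & antipode x = - (x * antipode g ^+ t)].

Inductive liu_gen := Liu_x | Liu_xV | Liu_g | Liu_y.

Definition liu_code (s : liu_gen) : nat :=
  match s with Liu_x => 0 | Liu_xV => 1 | Liu_g => 2 | Liu_y => 3 end.
Definition liu_decode (n : nat) : liu_gen :=
  match n with 0 => Liu_x | 1 => Liu_xV | 2 => Liu_g | _ => Liu_y end.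
Lemma liu_codeK : cancel liu_code liu_decode. Proof. by case. Qed.
HB.instance Definition _ := Choice.copy liu_gen (can_type liu_codeK).

Inductive liu_rel (k : fieldType) (n w : nat) (gamma : k) (A : lalgType k)
    (e : liu_gen -> A) : A -> A -> Prop :=
| Liu_xxV : liu_rel n w gamma e (e Liu_x * e Liu_xV) 1
| Liu_xVx : liu_rel n w gamma e (e Liu_xV * e Liu_x) 1
| Liu_xg : liu_rel n w gamma e (e Liu_x * e Liu_g) (e Liu_g * e Liu_x)
| Liu_xy : liu_rel n w gamma e (e Liu_x * e Liu_y) (e Liu_y * e Liu_x)
| Liu_yg :
    liu_rel n w gamma e (e Liu_y * e Liu_g) (gamma *: (e Liu_g * e Liu_y))
| Liu_yn : liu_rel n w gamma e (e Liu_y ^+ n) (1 - e Liu_x ^+ w)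
| Liu_gn : liu_rel n w gamma e (1 - e Liu_x ^+ w) (1 - e Liu_g ^+ n).

Definition is_liu (k : fieldType) (n w : nat) (gamma : k) (H : hopfAlgType k) :
    Prop :=
  exists e : liu_gen -> H, let g := e Liu_g in let y := e Liu_y in
    [/\ presents (liu_rel n w gamma (@fgen k liu_gen)) e,
        is_grouplike (e Liu_x),
        is_grouplike g,
        comul y = y *t g + 1 *t y
      & counit y = 0 /\ antipode y = - (y * antipode g)].

Inductive D_gen (m : nat) := Dx | DxV | Dg | DgV | Dy | Du of 'I_m.
Arguments Dx {m}.
Arguments DxV {m}.
Arguments Dg {m}.
Arguments DgV {m}.
Arguments Dy {m}.

Section DGenChoice.
Context (m : nat).
Definition D_code (s : D_gen m) : nat + 'I_m :=
  match s with
  | Dx => inl 0 | DxV => inl 1 | Dg => inl 2 | DgV => inl 3 | Dy => inl 4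
  | Du i => inr i
  end.
Definition D_decode (c : nat + 'I_m) : D_gen m :=
  match c with
  | inl 0 => Dx | inl 1 => DxV | inl 2 => Dg | inl 3 => DgV | inl _ => Dy
  | inr i => Du i
  end.
Lemma D_codeK : cancel D_code D_decode. Proof. by case. Qed.
HB.instance Definition _ := Choice.copy (D_gen m) (can_type D_codeK).
End DGenChoice.

Section D.
Context (k : fieldType) (m d : nat) (xi : k).
Local Notation omega := (m * d)%N.
Local Notation gamma := (xi ^+ 2).

Section Relations.
Context (A : lalgType k) (e : D_gen m -> A).
Local Notation x := (e Dx).
Local Notation xV := (e DxV).
Local Notation g := (e Dg).
Local Notation gV := (e DgV).
Local Notation y := (e Dy).

Definition D_xpow (n : int) : A :=
  match n with Posz p => x ^+ p | Negz p => xV ^+ p.+1 end.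

(* u_i for i in Z, the index being read modulo m; the default value 0 is not
   used when m > 0. *)
Definition D_u (i : int) : A :=
  if insub `|(i %% m)%Z|%N is Some j then e (Du j) else 0.

Definition D_phi (i : int) : A := 1 - gamma ^ (- i - 1) *: x ^+ d.

Definition D_P (i j : nat) : A :=
  if (i + j < m.-1)%N then
    (\prod_(i <= l < m.-1 - j) D_phi l) * y ^+ (i + j)
  else if (i + j == m.-1)%N then y ^+ (i + j)
  else (\prod_(i <= l < m) D_phi l) * (\prod_(0 <= l < m.-1 - j) D_phi l)
         * y ^+ (i + j - m).

Inductive D_rel : A -> A -> Prop :=
| D_xxV : D_rel (x * xV) 1
| D_xVx : D_rel (xV * x) 1
| D_ggV : D_rel (g * gV) 1
| D_gVg : D_rel (gV * g) 1
| D_xg : D_rel (x * g) (g * x)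
| D_xy : D_rel (x * y) (y * x)
| D_yg : D_rel (y * g) (gamma *: (g * y))
| D_ym : D_rel (y ^+ m) (1 - x ^+ omega)
| D_gm : D_rel (1 - x ^+ omega) (1 - g ^+ m)
| D_xu (i : 'I_m) : D_rel (x * D_u i) (D_u i * xV)
| D_yu (i : 'I_m) : D_rel (y * D_u i) (D_phi i * D_u (i%:Z + 1))
| D_uy (i : 'I_m) :
    D_rel (D_phi i * D_u (i%:Z + 1)) (xi *: (x ^+ d * D_u i * y))
| D_ug (i : 'I_m) :
    D_rel (D_u i * g) (gamma ^+ i *: (D_xpow (- (2 * d)%:Z) * g * D_u i))
| D_uu (i j : 'I_m) :
    D_rel (D_u i * D_u j)
      (((-1) ^- j * xi ^- j * gamma ^+ (j * j.+1)./2 / m%:R) *: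
         (D_xpow (- (((1 + m) * d)%N./2)%:Z) * D_P i j * g)).

End Relations.

(* The two integer halvings, of (1 + m) d in D_uu and of (1 - m) d in the
   antipode of u_i, are exact because (1 + m) d is assumed to be even. *)
Definition is_D (H : hopfAlgType k) : Prop :=
  exists e : D_gen m -> H,
    let x := e Dx in let g := e Dg in let y := e Dy in let u := D_u e in
    [/\ presents (D_rel (@fgen k (D_gen m))) e,
        [/\ comul x = x *t x, counit x = 1 & antipode x = e DxV],
        [/\ comul g = g *t g, counit g = 1 & antipode g = e DgV],
        [/\ comul y = y *t g + 1 *t y, counit y = 0
           & antipode y = - (y * e DgV)]
      & forall i : 'I_m,
        [/\ comul (u i) =
              \sum_(j < m) gamma ^ (j%:Z * (i%:Z - j%:Z)) *:
                (u j *t (D_xpow e (- (j * d)%:Z) * g ^+ j * u (i%:Z - j%:Z))),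
            counit (u i) = (i == 0 :> nat)%:R
          & antipode (u i) =
              ((-1) ^+ i * xi ^- i * gamma ^- (i * i.+1)./2) *:
                (D_xpow e ((i * d)%:Z + 3 * (((1 - m%:Z) * d%:Z) %/ 2)%Z)
                   * g ^+ (m - i - 1) * u i)]].

End D.

(* Main.v *)
From HB Require Import structures.
Require Import Defs.
From mathcomp Require Import all_boot all_order all_algebra.
From mathcomp Require Import finmap zify ring.
From mathcomp.multinomials Require Import monalg.

(** An isomorphism of Hopf algebras carries representations of H = D(m,d,xi)
    to the other algebra, so a few small representations of H settle every
    comparison. Write gamma for xi^2 and S for the antipode.

    The main representation is two-dimensional. The generator x acts as
    diag(a, a^-1), where a^d = gamma if m > 1 and a = 2 if m = 1; g acts
    diagonally; y acts as 0 if m > 1 and as 1 - x^d if m = 1; every u_i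
    exchanges the two coordinate lines, up to scalars that may be 0. The
    commutator of x with the sum of the u_i is invertible
    ([D_rep2_m1], [D_rep2_y0]), so the image of H is not commutative and has no
    common eigenvector ([rep_ncomm], [rep_no_eigen]). Moreover S^2 acts trivially
    on it ([D_antipode_square]): in H, S^2 fixes x and g, multiplies y by
    gamma^-1 and sends u_i to gamma^-i x^((1-m)d) u_i, and once y acts as 0 the
    relation y u_i = phi_i u_(i+1) says that x^d u_i = gamma^i u_i.

    - k[x] and k[x^+-1] are commutative.
    - In a generalized Liu algebra S^2(y) = g y g^-1. Where S^2 acts trivially, the
      images of y and g therefore commute, and the whole image is commutative
      ([liu_no_rep2]).
    - In a Taft algebra with n > 2, taking determinants in x g = eta g x shows that
      x is singular; its kernel is then a common eigenline, unless x = 0 and the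
      image is commutative ([taft_no_rep2]). For n = 2 a one-dimensional
      representation kills x and sends g to 1 or -1, so there are at most two of
      them ([taft2_two_chars]), whereas H has three ([D_three_chars]).
    - The infinite dihedral group is generated by the involutions g and gx, so
      each character of its group algebra is its own inverse for convolution
      ([dihedral_char_square]). For m > 1, H has a character which sends u_0 to
      xi and the other u_i to 0; its convolution square takes the value gamma on
      u_0, and gamma differs from 1, the value of the counit ([D_char_square]).

    Two general facts carry this: the universal property of an algebra given by
    generators and relations ([presents_lift]), which reduces the construction of
    a representation to checking the defining relations, and the
    antimultiplicativity of the antipode ([antipodeM]), which lets S^2 be computed
    on generators. *)

Set Implicit Arguments.
Unset Strict Implicit.
Unset Printing Implicit Defensive.

Import GRing.Theory.
Local Open Scope ring_scope.

(** * Linear maps and tensor products *)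

(** The maps fed to [tlift] are lambda terms, so their linearity is a
    hypothesis and not a structure. *)
Lemma linear_map0 (k : fieldType) (V W : lmodType k) (f : V -> W) :
  linear f -> f 0 = 0.
Proof. by move=> fl; have := fl (-1) 0 0; rewrite scaler0 addr0 scaleN1r addNr. Qed.

Lemma linear_mapZ (k : fieldType) (V W : lmodType k) (f : V -> W) :
  linear f -> forall c v, f (c *: v) = c *: f v.
Proof.
by move=> fl c v; have := fl c v 0; rewrite (linear_map0 fl) !addr0.
Qed.

Lemma linear_mapD (k : fieldType) (V W : lmodType k) (f : V -> W) :
  linear f -> {morph f : v w / v + w}.
Proof. by move=> fl v w; have := fl 1 v w; rewrite !scale1r. Qed.

Lemma linear_map_sum (k : fieldType) (V W : lmodType k) (f : V -> W) I
    (s : seq I) (F : I -> V) :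
  linear f -> f (\sum_(i <- s) F i) = \sum_(i <- s) f (F i).
Proof.
by move=> fl; apply: (big_morph f (linear_mapD fl) (linear_map0 fl)).
Qed.

Section Sweedler.
Context (k : fieldType).

Definition bilin (V W U : lmodType k) (f : V -> W -> U) : Prop :=
  (forall w, linear (f^~ w)) /\ (forall v, linear (f v)).

(** One way of writing a tensor as a finite sum of pure tensors, with the
    coefficients absorbed into the left factors; it makes Sweedler sums into
    sums over a list. *)
Definition tensor_terms (V W : lmodType k) (t : tensor V W) : seq (V * W) :=
  [seq ((trepr t)@_x *: x.1, x.2) | x <- msupp (trepr t)].

(** Linearity in the left variable alone suffices: the coefficients sit in the
    left factors. *)
Lemma tlift_terms (V W U : lmodType k) (f : V -> W -> U) t :
  (forall w, linear (f^~ w)) ->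
  tlift f t = \sum_(p <- tensor_terms t) f p.1 p.2.
Proof.
move=> fl; rewrite /tlift /mlift big_map; apply: eq_bigr => x _ /=.
by rewrite (linear_mapZ (fl x.2)).
Qed.

Lemma tensor_termsK (V W : lmodType k) (t : tensor V W) :
  t = \sum_(p <- tensor_terms t) (p.1 *t p.2).
Proof.
rewrite big_map -{1}(treprK t) {1}[trepr t]monalgE.
rewrite (big_morph _ (@tpiD k V W) (_ : _ = 0)); last first.
  by apply: (addrI (tpi 0)); rewrite -tpiD !addr0.
apply: eq_bigr => x _ /=.
rewrite (linear_mapZ (@tens_linl _ _ _ x.2)) /tens -[_ *: tpi _]tpiZ; congr tpi.
by apply/malgP => y; rewrite mcoeffZ !mcoeffU mulr_natr; case: x => ? ?.
Qed.

Lemma tlift_tensE (V W U : lmodType k) (f : V -> W -> U) v w :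
  bilin f -> tlift f (v *t w) = f v w.
Proof. by case=> ? ?; apply: tlift_tens. Qed.

Lemma tlift_linear (V W U : lmodType k) (f : V -> W -> U) :
  bilin f -> linear (tlift f).
Proof. by case=> ? ?; apply: tlift_is_linear. Qed.

Lemma tlift_param_linear (V W U X : lmodType k) (f : X -> V -> W -> U) t :
  (forall x, bilin (f x)) -> (forall v w, linear (fun x => f x v w)) ->
  linear (fun x => tlift (f x) t).
Proof.
move=> fb fx c x y; have E z := tlift_terms t (fb z).1.
rewrite (E (c *: x + y)) (E x) (E y) scaler_sumr -big_split.
by apply: eq_bigr => p _; apply: fx.
Qed.

Lemma tens_bilin (V W : lmodType k) : bilin (@tens k V W).
Proof. by split; [apply: tens_linl | apply: tens_linr]. Qed.

Lemma bilin_comp (V W V' W' U : lmodType k) (f : V' -> W' -> U)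
    (g : V -> V') (h : W -> W') :
  bilin f -> linear g -> linear h -> bilin (fun v w => f (g v) (h w)).
Proof.
move=> [fl fr] gl hl.
by split=> z c v w; [rewrite gl fl | rewrite hl fr].
Qed.

Lemma tmap_tens (V W V' W' : lmodType k) (f : V -> V') (g : W -> W') v w :
  linear f -> linear g -> tmap f g (v *t w) = f v *t g w.
Proof.
move=> fl gl; rewrite /tmap tlift_tensE //.
by apply: bilin_comp => //; apply: tens_bilin.
Qed.

Lemma tmap_linear (V W V' W' : lmodType k) (f : V -> V') (g : W -> W') :
  linear f -> linear g -> linear (tmap f g).
Proof. by move=> *; apply: tlift_linear; apply: bilin_comp => //; apply: tens_bilin. Qed.

Lemma tlift_tmap (V W V' W' U : lmodType k) (f : V -> V') (g : W -> W')
    (h : V' -> W' -> U) t :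
  linear f -> linear g -> bilin h ->
  tlift h (tmap f g t) = tlift (fun v w => h (f v) (g w)) t.
Proof.
move=> fl gl hl; have hfg := bilin_comp hl fl gl.
rewrite [t]tensor_termsK !(linear_map_sum _ _ (tmap_linear fl gl)).
rewrite !(linear_map_sum _ _ (tlift_linear hl)) (linear_map_sum _ _ (tlift_linear hfg)).
by apply: eq_bigr => p _; rewrite tmap_tens // !tlift_tensE.
Qed.

Section TMul.
Context (A B : algType k).

Let tmul_aux_bilin (a : A) (b : B) :
  bilin (fun (a' : A) (b' : B) => (a * a') *t (b * b')).
Proof.
apply: bilin_comp; first exact: tens_bilin.
  by move=> c v w; rewrite mulrDr scalerAr.
by move=> c v w; rewrite mulrDr scalerAr.
Qed.

Let tmul_outer_bilin (t : tensor A B) :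
  bilin (fun a b => tlift (fun a' b' => (a * a') *t (b * b')) t).
Proof.
split=> z.
  apply: (tlift_param_linear t (f := fun a a' b' => (a * a') *t (z * b'))) => //.
  by move=> a' b' c a a2; rewrite mulrDl -scalerAl tens_linl.
apply: (tlift_param_linear t (f := fun b a' b' => (z * a') *t (b * b'))) => //.
by move=> a' b' c b b2; rewrite mulrDl -scalerAl tens_linr.
Qed.

Lemma tmul_linl (t : tensor A B) : linear (fun s => tmul s t).
Proof. exact: tlift_linear. Qed.

Lemma tmul_linr (s : tensor A B) : linear (tmul s).
Proof.
move=> c t t'.
have E r : tmul s r = \sum_(p <- tensor_terms s)
    tlift (fun a' b' => (p.1 * a') *t (p.2 * b')) r.
  exact: (tlift_terms s (tmul_outer_bilin r).1).
rewrite (E (c *: t + t')) (E t) (E t') scaler_sumr -big_split.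
apply: eq_bigr => p _.
exact: (tlift_linear (tmul_aux_bilin _ _)).
Qed.

Lemma tmul_tens (a a' : A) (b b' : B) :
  tmul (a *t b) (a' *t b') = (a * a') *t (b * b').
Proof. by rewrite /tmul !tlift_tensE. Qed.

End TMul.

Section TAssoc.
Context (U V W : lmodType k).

Let tassoc_aux_bilin (w : W) : bilin (fun (u : U) (v : V) => u *t (v *t w)).
Proof.
by split=> z c v v' /=; rewrite ?tens_linl ?tens_linr.
Qed.

Let tassoc_outer_bilin :
  bilin (fun s (w : W) => tlift (fun (u : U) (v : V) => u *t (v *t w)) s).
Proof.
split=> [w|s]; first exact: tlift_linear.
apply: (tlift_param_linear s (f := fun w u v => u *t (v *t w))) => //.
by move=> u v c w w'; rewrite tens_linr tens_linr.
Qed.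

Lemma tassoc_linear : linear (@tassoc k U V W).
Proof. exact: tlift_linear. Qed.

Lemma tassoc_tens (u : U) (v : V) (w : W) : tassoc ((u *t v) *t w) = u *t (v *t w).
Proof. by rewrite /tassoc !tlift_tensE. Qed.

End TAssoc.

End Sweedler.

(** * The antipode is antimultiplicative *)

Section Antipode.
Context (k : fieldType) (H : hopfAlgType k).
Implicit Types a b : H.

HB.instance Definition _ :=
  GRing.isLinear.Build k H (tensor H H) *:%R comul (@comul_is_linear k H).
HB.instance Definition _ :=
  GRing.isLinear.Build k H H *:%R antipode (@antipode_is_linear k H).
HB.instance Definition _ :=
  GRing.isLinear.Build k H k *%R counit (@counit_is_scalar k H).

(** Sweedler notation: [p.1] and [p.2], for [p] in [sw a], are the two legs of
    the coproduct of [a]. *)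
Definition sw a : seq (H * H) := tensor_terms (comul a).

Lemma sw_tlift (U : lmodType k) (f : H -> H -> U) a :
  (forall w, linear (f^~ w)) ->
  tlift f (comul a) = \sum_(p <- sw a) f p.1 p.2.
Proof. exact: tlift_terms. Qed.

Lemma sw_counitl a : \sum_(p <- sw a) counit p.1 *: p.2 = a.
Proof.
rewrite -{2}[a]counitl sw_tlift // => w c v v'.
by rewrite linearP /= scalerDl scalerA.
Qed.

Lemma sw_counitr a : \sum_(p <- sw a) counit p.2 *: p.1 = a.
Proof.
rewrite -{2}[a]counitr sw_tlift // => w c v v'.
by rewrite scalerDr !scalerA mulrC.
Qed.

Lemma sw_antipodel a : \sum_(p <- sw a) antipode p.1 * p.2 = (counit a)%:A.
Proof.
rewrite -antipodel sw_tlift // => w c v v'.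
by rewrite linearP mulrDl scalerAl.
Qed.

Lemma sw_antipoder a : \sum_(p <- sw a) p.1 * antipode p.2 = (counit a)%:A.
Proof.
rewrite -antipoder sw_tlift // => w c v v'.
by rewrite mulrDl scalerAl.
Qed.

Lemma sw_mul (U : lmodType k) (f : H -> H -> U) a b : bilin f ->
  \sum_(p <- sw (a * b)) f p.1 p.2 =
  \sum_(p <- sw a) \sum_(q <- sw b) f (p.1 * q.1) (p.2 * q.2).
Proof.
move=> fl; rewrite -sw_tlift; last by case: fl.
rewrite comulM [in LHS](tensor_termsK (comul a)) [in LHS](tensor_termsK (comul b)).
rewrite (linear_map_sum _ _ (tmul_linl _)) (linear_map_sum _ _ (tlift_linear fl)).
apply: eq_bigr => p _.
rewrite (linear_map_sum _ _ (tmul_linr _)) (linear_map_sum _ _ (tlift_linear fl)).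
by apply: eq_bigr => q _; rewrite tmul_tens tlift_tensE.
Qed.

Definition trilin (U : lmodType k) (f : H -> H -> H -> U) : Prop :=
  [/\ forall y z, linear (fun x => f x y z), forall x z, linear (fun y => f x y z)
    & forall x y, linear (f x y)].

Lemma sw_coassoc (U : lmodType k) (f : H -> H -> H -> U) a : trilin f ->
  \sum_(p <- sw a) \sum_(q <- sw p.2) f p.1 q.1 q.2 =
  \sum_(p <- sw a) \sum_(q <- sw p.1) f q.1 q.2 p.2.
Proof.
case=> f1 f2 f3.
have b23 x : bilin (f x) by split.
have bT : bilin (fun x s => tlift (f x) s).
  split=> [s|x]; last exact: tlift_linear.
  exact: (tlift_param_linear s b23 f1).
have cl : linear (@comul k H) by apply: comul_is_linear.
have il (V : lmodType k) : linear (@idfun V) by [].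
have cib := bilin_comp (tens_bilin _ _) cl (il H).
have /(congr1 (tlift (fun x s => tlift (f x) s))) := @comulA k H a.
rewrite tlift_tmap // sw_tlift; last by case: (bilin_comp bT (il _) cl).
under eq_bigr => p _ do rewrite sw_tlift ?(b23 _).1 //=.
move=> <-; rewrite {1}/tmap sw_tlift; last exact: cib.1.
rewrite (linear_map_sum _ _ (@tassoc_linear k _ _ _)) (linear_map_sum _ _ (tlift_linear bT)).
apply: eq_bigr => p _; rewrite [comul p.1]tensor_termsK.
rewrite (linear_map_sum _ _ (@tens_linl k _ _ _)).
rewrite (linear_map_sum _ _ (@tassoc_linear k _ _ _)) (linear_map_sum _ _ (tlift_linear bT)).
by apply: eq_bigr => q _; rewrite tassoc_tens !tlift_tensE.
Qed.

Lemma antipode1 : antipode (1 : H) = 1.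
Proof.
have bS : bilin (fun b c : H => antipode b * c).
  split=> [w c v v'|v c w w']; first by rewrite linearP mulrDl scalerAl.
  by rewrite mulrDr scalerAr.
by have := @antipodel k H 1; rewrite comul1 tlift_tensE // mulr1 counit1 scale1r.
Qed.

(** In Sweedler notation both sides equal
    S(b1) S(a1) a2 b2 S(a3 b3). The factor a2 b2 S(a3 b3) is the convolution of
    the identity and S at a2 b2, which leaves S(b) S(a). Regrouping by
    coassociativity, S(a1) a2 and then S(b1) b2 collapse, which leaves S(ab). *)
Lemma antipodeM a b : antipode (a * b) = antipode b * antipode a.
Proof.
pose E := \sum_(p <- sw a) \sum_(q <- sw b)
  antipode q.1 * antipode p.1 * ((counit (p.2 * q.2))%:A).
have -> : antipode b * antipode a = E.
  rewrite -{1}[a]sw_counitr -{1}[b]sw_counitr !linear_sum /= mulr_sumr.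
  apply: eq_bigr => p _; rewrite mulr_suml; apply: eq_bigr => q _.
  rewrite !linearZ /= -!(scalerAl, scalerAr) scalerA mulr1 counitM mulrC.
  by [].
transitivity (\sum_(q <- sw b) \sum_(p <- sw a) \sum_(r <- sw p.2)
   (\sum_(s <- sw q.2) antipode q.1 * antipode p.1 * r.1 * s.1 * antipode (r.2 * s.2))).
  pose f2 x y z := antipode x * y * antipode (a * z).
  transitivity (\sum_(q <- sw b) \sum_(s <- sw q.2) f2 q.1 s.1 s.2).
    rewrite sw_coassoc; last first.
      split=> x y c v w; rewrite /f2.
      - by rewrite linearP !mulrDl -!scalerAl.
      - by rewrite mulrDr mulrDl -scalerAr -scalerAl.
      - by rewrite mulrDr -scalerAr linearP mulrDr -scalerAr.
    rewrite -{1}[b]sw_counitl mulr_sumr linear_sum; apply: eq_bigr => q _ /=.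
    rewrite /f2 -mulr_suml sw_antipodel -scalerAl mul1r.
    by rewrite -scalerAr linearZ.
  apply: eq_bigr => q _.
  pose f3 x y z := \sum_(s <- sw q.2)
    antipode q.1 * antipode x * y * s.1 * antipode (z * s.2).
  transitivity (\sum_(p <- sw a) \sum_(r <- sw p.2) f3 p.1 r.1 r.2) => //.
    rewrite sw_coassoc; last first.
      split=> x y c v w; rewrite /f3 scaler_sumr -big_split; apply: eq_bigr => s _ /=.
      - by rewrite linearP !(mulrDr, mulrDl) -!(scalerAl, scalerAr).
      - by rewrite !(mulrDr, mulrDl) -!(scalerAl, scalerAr).
      - by rewrite !(mulrDr, mulrDl) -!(scalerAl, scalerAr) linearP mulrDr -scalerAr.
    transitivity (\sum_(p <- sw a) f3 1 (counit p.1)%:A p.2).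
      rewrite /f3 exchange_big; apply: eq_bigr => s _.
      rewrite /f2 -{1}[a]sw_counitl mulr_suml linear_sum mulr_sumr /=.
      apply: eq_bigr => p _; rewrite antipode1 mulr1.
      by rewrite -!(scalerAl, scalerAr) linearZ mulr1 /= -!(scalerAl, scalerAr).
    apply: eq_bigr => p _; rewrite /f3 exchange_big; apply: eq_bigr => s _.
    rewrite antipode1 mulr1 -sw_antipodel mulr_sumr !mulr_suml.
    by apply: eq_bigr => r _; rewrite !mulrA.
rewrite exchange_big; apply: eq_bigr => p _; apply: eq_bigr => q _.
rewrite -sw_antipoder mulr_sumr.
rewrite (sw_mul (f := fun x y => antipode q.1 * antipode p.1 * (x * antipode y))).
  by apply: eq_bigr => r _; apply: eq_bigr => s _; rewrite !mulrA.
split=> x c v w; rewrite ?linearP !(mulrDr, mulrDl) -!(scalerAl, scalerAr) //.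
Qed.

Lemma antipodeXn a n : antipode (a ^+ n) = antipode a ^+ n.
Proof.
elim: n => [|n IH]; first by rewrite !expr0 antipode1.
by rewrite exprS antipodeM IH -exprSr.
Qed.

Lemma antipode_inv a a' : a * a' = 1 -> a' * a = 1 -> antipode a = a' ->
  antipode a' = a.
Proof.
move=> aa' a'a Sa; have := antipodeM a a'; rewrite aa' antipode1 Sa => /esym E.
by rewrite -[antipode a']mulr1 -a'a mulrA E mul1r.
Qed.

End Antipode.

(** * Algebras given by generators and relations *)

Section Eval.
Context (k : fieldType) (I : choiceType) (A : algType k) (e : I -> A).
Local Notation F := {malg k[{fmonom I}]}.

Lemma eval_monom_morph : mmorphism (eval_monom e).
Proof.
split=> [v w|]; last by rewrite /eval_monom fm1 big_nil.
by rewrite /eval_monom fmM big_cat.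
Qed.

HB.instance Definition _ :=
  isMultiplicative.Build {fmonom I} A (eval_monom e) eval_monom_morph.

Lemma eval_monoid_morphism : monoid_morphism (eval e).
Proof.
have [M one] : multiplicative (eval e : F -> A).
  apply: commr_mmap_is_multiplicative => s v w.
  by rewrite /GRing.comm /= mulr_algl mulr_algr.
by split.
Qed.

Lemma eval_linear : linear (eval e).
Proof.
by move=> c s t; rewrite /eval raddfD /= mmapZ /= mulr_algl.
Qed.

HB.instance Definition _ := GRing.isLinear.Build k F A *:%R (eval e) eval_linear.
HB.instance Definition _ :=
  GRing.isMonoidMorphism.Build F A (eval e) eval_monoid_morphism.

Lemma eval_gen i : eval e (fgen k i) = e i.
Proof.
by rewrite /eval /fgen mmapU /= scale1r mul1r /eval_monom fmU big_seq1.
Qed.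

Lemma eval_rel_ideal (R : F -> F -> Prop) s :
  (forall a b, R a b -> eval e a = eval e b) -> rel_ideal R s -> eval e s = 0.
Proof.
move=> eR; elim=> [a b c d' /eR eab||a b _ a0 _ b0].
- by rewrite !rmorphM rmorphB /= eab subrr mulr0 mul0r.
- exact: rmorph0.
- by rewrite rmorphD /= a0 b0 addr0.
Qed.

Lemma eval_ind (P : A -> Prop) s :
  (forall c a b, P a -> P b -> P (c *: a + b)) -> P 1 ->
  (forall a b, P a -> P b -> P (a * b)) -> (forall i, P (e i)) ->
  P (eval e s).
Proof.
move=> PD P1 PM Pe.
have P0 : P 0 by have := PD (-1) 1 1 P1 P1; rewrite scaleN1r addNr.
rewrite /eval /mmap; elim/big_rec: _ => // w a _ Pa.
by rewrite mulr_algl; apply: PD => //; apply: (big_ind P).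
Qed.

End Eval.

Section Presents.
Context (k : fieldType) (I : choiceType).
Context (R : {malg k[{fmonom I}]} -> {malg k[{fmonom I}]} -> Prop).
Context (A : algType k) (e : I -> A) (pe : presents R e).

Lemma presents_rel a b : R a b -> eval e a = eval e b.
Proof.
move=> Rab; apply/eqP; rewrite -subr_eq0 -rmorphB; apply/eqP/pe.2.
by rewrite -[a - b]mul1r -[_ * _]mulr1; apply: RelIdeal_gen.
Qed.

Lemma presents_ind (P : A -> Prop) :
  (forall c a b, P a -> P b -> P (c *: a + b)) -> P 1 ->
  (forall a b, P a -> P b -> P (a * b)) -> (forall i, P (e i)) ->
  forall a, P a.
Proof. by move=> PD P1 PM Pe a; have [s <-] := pe.1 a; apply: eval_ind. Qed.

(** The universal property of the quotient of the free algebra: a preimage of an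
    element is chosen, and the value does not depend on the choice because the
    evaluation kills the ideal of relations. *)
Lemma presents_lift (B : algType k) (e' : I -> B) :
  (forall a b, R a b -> eval e' a = eval e' b) ->
  exists f : {lrmorphism A -> B}, forall i, f (e i) = e' i.
Proof.
move=> e'R.
have surj a : exists s, eval e s == a by have [s <-] := pe.1 a; exists s; apply: eqxx.
pose f a := eval e' (xchoose (surj a)).
have fE s : f (eval e s) = eval e' s.
  apply/eqP; rewrite -subr_eq0 -rmorphB; apply/eqP; apply: (eval_rel_ideal e'R).
  by apply/pe.2; rewrite rmorphB /= (eqP (xchooseP (surj _))) subrr.
have fl : linear f.
  move=> c a b; have [s <-] := pe.1 a; have [t <-] := pe.1 b.
  by rewrite -linearP !fE linearP.
have fm : monoid_morphism f.
  split=> [|a b]; first by rewrite -(rmorph1 (eval e)) fE rmorph1.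
  have [s <-] := pe.1 a; have [t <-] := pe.1 b.
  by rewrite -rmorphM !fE rmorphM.
pose fL := GRing.isLinear.Build k A B *:%R f fl.
pose fM := GRing.isMonoidMorphism.Build A B f fm.
pose g : {lrmorphism A -> B} := HB.pack f fL fM.
by exists g => i; have := fE (fgen k i); rewrite !eval_gen.
Qed.

Lemma presents_eq_on (B : algType k) (f f' : {lrmorphism A -> B}) :
  (forall i, f (e i) = f' (e i)) -> f =1 f'.
Proof.
move=> ff'; apply: presents_ind => [c a b fa fb||a b fa fb|//].
- by rewrite !linearP /= fa fb.
- by rewrite !rmorph1.
- by rewrite !rmorphM /= fa fb.
Qed.

End Presents.

(** * The relations of D(m,d,xi) *)

(** The expressions that occur in the relations are natural in the algebra, so
    relations pass from the free algebra to any algebra that it maps to. *)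
Section DMorph.
Context (k : fieldType) (m d : nat) (xi : k) (A B : lalgType k).
Context (f : {lrmorphism A -> B}) (e : D_gen m -> A) (e' : D_gen m -> B).
Hypothesis fe : forall i, f (e i) = e' i.

Lemma D_xpow_morph n : f (D_xpow e n) = D_xpow e' n.
Proof. by case: n => n; rewrite /D_xpow -fe (rmorphXn f). Qed.

Lemma D_u_morph i : f (D_u e i) = D_u e' i.
Proof. by rewrite /D_u; case: insubP => [j _ _|_]; rewrite ?rmorph0. Qed.

Lemma D_phi_morph i : f (D_phi d xi e i) = D_phi d xi e' i.
Proof. by rewrite /D_phi rmorphB rmorph1 /= -fe -(rmorphXn f) -(linearZ_LR f). Qed.

Lemma D_P_morph i j : f (D_P d xi e i j) = D_P d xi e' i j.
Proof.
have prodE a b : f (\prod_(a <= l < b) D_phi d xi e l) =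
    \prod_(a <= l < b) D_phi d xi e' l.
  by rewrite rmorph_prod; apply: eq_bigr => l _; apply: D_phi_morph.
by rewrite /D_P; do 2?case: ifP => _; rewrite ?rmorphM /= ?rmorphXn /= ?fe ?prodE.
Qed.

Lemma D_rel_morph a b : D_rel d xi e a b -> D_rel d xi e' (f a) (f b).
Proof.
case=> *; rewrite ?(rmorphM f) /= ?D_phi_morph ?D_u_morph ?fe.
all: rewrite ?(rmorphB, rmorph1, rmorphM, linearZ) /=.
all: rewrite ?rmorphXn /= ?D_xpow_morph ?D_P_morph ?D_u_morph ?fe.
all: rewrite ?rmorphM /= ?rmorphXn /= ?D_xpow_morph ?D_P_morph ?D_u_morph ?fe.
all: by constructor.
Qed.

End DMorph.

Lemma D_uE (k : fieldType) m (A : lalgType k) (e : D_gen m -> A) (i : 'I_m) :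
  D_u e i = e (Du i).
Proof.
rewrite /D_u modz_nat absz_nat modn_small //.
by rewrite (insubT (fun j => j < m)%N (ltn_ord i)); congr (e (Du _)); apply: val_inj.
Qed.

Lemma D_u_addm (k : fieldType) m (A : lalgType k) (e : D_gen m -> A) (i : int) :
  D_u e (i + m) = D_u e i.
Proof. by rewrite /D_u modzDr. Qed.

Lemma D_xpowN (k : fieldType) m (A : lalgType k) (e : D_gen m -> A) n :
  D_xpow e (- n%:Z) = e DxV ^+ n.
Proof. by case: n. Qed.

Definition D_sat (k : fieldType) (m d : nat) (xi : k) (A : lalgType k)
    (e : D_gen m -> A) : Prop :=
  forall a b, D_rel d xi e a b -> a = b.

Lemma D_sat_morph (k : fieldType) (m d : nat) (xi : k) (A B : lalgType k)
    (g : {lrmorphism A -> B}) (e : D_gen m -> A) (e' : D_gen m -> B) :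
  (forall i, g (e i) = e' i) -> (forall s t, D_rel d xi e s t -> g s = g t) ->
  D_sat d xi e'.
Proof.
move=> ge E.
have gx := D_xpow_morph ge; have gu := D_u_morph ge.
have gp := D_phi_morph d xi ge; have gP := D_P_morph d xi ge.
move=> a b [|||||||||i|i|i|i|i j].
- by have := E _ _ (D_xxV _ _ _); rewrite !(rmorphM, rmorph1) /= !ge.
- by have := E _ _ (D_xVx _ _ _); rewrite !(rmorphM, rmorph1) /= !ge.
- by have := E _ _ (D_ggV _ _ _); rewrite !(rmorphM, rmorph1) /= !ge.
- by have := E _ _ (D_gVg _ _ _); rewrite !(rmorphM, rmorph1) /= !ge.
- by have := E _ _ (D_xg _ _ _); rewrite !rmorphM /= !ge.
- by have := E _ _ (D_xy _ _ _); rewrite !rmorphM /= !ge.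
- by have := E _ _ (D_yg _ _ _); rewrite (linearZ_LR g) /= !rmorphM /= !ge.
- by have := E _ _ (D_ym _ _ _); rewrite rmorphB rmorph1 /= !rmorphXn /= !ge.
- by have := E _ _ (D_gm _ _ _); rewrite !rmorphB !rmorph1 /= !rmorphXn /= !ge.
- by have := E _ _ (D_xu _ _ _ i); rewrite !rmorphM /= !gu !ge.
- by have := E _ _ (D_yu _ _ _ i); rewrite !rmorphM /= !gu !gp !ge.
- by have := E _ _ (D_uy _ _ _ i); rewrite (linearZ_LR g) /= !rmorphM /= rmorphXn /= !gu !gp !ge.
- by have := E _ _ (D_ug _ _ _ i); rewrite (linearZ_LR g) /= !rmorphM /= !gu !gx !ge.
- by have := E _ _ (D_uu _ _ _ i j); rewrite (linearZ_LR g) /= !rmorphM /= !gu !gx !gP !ge.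
Qed.

Section DModel.
Context (k : fieldType) (m d : nat) (xi : k).
Context (H : algType k) (e : D_gen m -> H).
Hypothesis pe : presents (D_rel d xi (@fgen k (D_gen m))) e.

Lemma presents_D_lift (B : algType k) (e' : D_gen m -> B) : D_sat d xi e' ->
  exists f : {lrmorphism H -> B}, forall i, f (e i) = e' i.
Proof.
move=> e'R; apply: (presents_lift pe) => a b Rab; apply: e'R.
by apply: D_rel_morph Rab => i; apply: eval_gen.
Qed.

Lemma presents_D_sat (B : algType k) (f : {lrmorphism H -> B}) (e' : D_gen m -> B) :
  (forall i, f (e i) = e' i) -> D_sat d xi e'.
Proof.
move=> fe; apply: (D_sat_morph (g := f \o eval e) (e := @fgen k _)) => [i|s t Rst].
  by rewrite /= eval_gen.
by rewrite /= (presents_rel pe Rst).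
Qed.

End DModel.

Lemma comm_inv (A : pzRingType) (x xV z : A) : x * xV = 1 -> xV * x = 1 ->
  z * x = x * z -> z * xV = xV * z.
Proof.
move=> xxV xVx zx; rewrite -[z in LHS]mul1r -xVx -[_ * z]mulrA -zx.
by rewrite -!mulrA xxV mulr1.
Qed.

Section DCalc.
Context (k : fieldType) (m d : nat) (xi : k) (B : algType k) (e : D_gen m -> B).
Hypothesis eR : D_sat d xi e.
Local Notation x := (e Dx).
Local Notation xV := (e DxV).
Local Notation g := (e Dg).
Local Notation gV := (e DgV).
Local Notation y := (e Dy).
Local Notation gamma := (xi ^+ 2).

Lemma D_xpow_succ n : D_xpow e (n + 1) = D_xpow e n * x.
Proof.
case: n => [n|[|n]]; first by rewrite -PoszD addn1 /= exprSr.
  by rewrite /= expr1 (eR (D_xVx _ _ _)).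
have -> : Negz n.+1 + 1 = Negz n by lia.
by rewrite /= [in RHS]exprSr -mulrA (eR (D_xVx _ _ _)) mulr1.
Qed.

Lemma D_xpow_pred n : D_xpow e (n - 1) = D_xpow e n * xV.
Proof.
by rewrite -[n in RHS](subrK 1) D_xpow_succ -mulrA (eR (D_xxV _ _ _)) mulr1.
Qed.

Lemma D_xpowD a b : D_xpow e (a + b) = D_xpow e a * D_xpow e b.
Proof.
elim/int_rect: b => [|n IH|n IH]; first by rewrite addr0 mulr1.
  by rewrite -[n.+1]addn1 PoszD addrA !D_xpow_succ IH mulrA.
rewrite (_ : - _ = - n%:Z - 1); last lia.
by rewrite addrA !D_xpow_pred IH mulrA.
Qed.

Lemma D_u_xpow i n : (i < m)%N -> D_u e i * D_xpow e n = D_xpow e (- n) * D_u e i.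
Proof.
move=> im; have ux : D_u e i * x = xV * D_u e i.
  rewrite -[D_u e i in LHS]mul1r -(eR (D_xVx _ _ _)) -[xV * x * _]mulrA.
  by rewrite (eR (D_xu d xi e (Ordinal im))) -!mulrA (eR (D_xVx _ _ _)) mulr1.
have uxV : D_u e i * xV = x * D_u e i by rewrite (eR (D_xu d xi e (Ordinal im))).
elim/int_rect: n => [|n IH|n IH]; first by rewrite oppr0 mulr1 mul1r.
  rewrite -[n.+1]addn1 PoszD D_xpow_succ mulrA IH -mulrA ux mulrA -D_xpow_pred.
  by congr (D_xpow _ _ * _); lia.
rewrite (_ : - n.+1%:Z = - n%:Z - 1); last lia.
rewrite D_xpow_pred mulrA IH -mulrA uxV mulrA -D_xpow_succ.
by congr (D_xpow _ _ * _); lia.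
Qed.

Lemma D_xpow_comm z n : z * x = x * z -> z * D_xpow e n = D_xpow e n * z.
Proof.
move=> zx; have zxV := comm_inv (eR (D_xxV _ _ _)) (eR (D_xVx _ _ _)) zx.
by case: n => n; [apply: commrX zx | apply: commrX zxV].
Qed.

End DCalc.

(** * The square of the antipode *)

Section DAntipode.
Context (k : fieldType) (m d : nat) (xi : k).
Local Notation gamma := (xi ^+ 2).
Hypothesis m_gt0 : (0 < m)%N.
Hypothesis xi_prim : (2 * m).-primitive_root xi.

Lemma gamma_prim : m.-primitive_root gamma.
Proof.
have := exp_prim_root xi_prim 2; rewrite gcdnMr mulKn //.
Qed.

Lemma xi_m : xi ^+ m = -1.
Proof.
have : xi ^+ m ^+ 2 == 1 by rewrite -exprM mulnC prim_expr_order.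
rewrite sqrf_eq1 => /orP[|/eqP //].
by rewrite -(prim_order_dvd xi_prim) => /dvdn_leq; lia.
Qed.

Lemma xi_neq0 : xi != 0.
Proof.
by apply: contra_eq_neq (xi_m) => ->; rewrite expr0n gtn_eqF //= eq_sym oppr_eq0 oner_eq0.
Qed.

Hypothesis md_even : ~~ odd ((1 + m) * d).

Section Calc2.
Context (B : algType k) (e : D_gen m -> B) (eR : D_sat d xi e).
Hypothesis my : m = 1%N \/ e Dy = 0.
Local Notation x := (e Dx).
Local Notation xV := (e DxV).
Local Notation g := (e Dg).
Local Notation gV := (e DgV).
Local Notation y := (e Dy).

(** Since y = 0, the relation y u_(i-1) = phi_(i-1) u_i reads
    (1 - gamma^-i x^d) u_i = 0. *)
Lemma D_xd_u_eigen (i : nat) : (i < m)%N -> m <> 1%N ->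
  D_xpow e d * D_u e i = gamma ^+ i *: D_u e i.
Proof.
move=> im m1; case: my => [//|y0].
have g0 : gamma != 0 by rewrite expf_neq0 // xi_neq0.
case: i im => [|i] im.
  have Hm1 : (m.-1 < m)%N by rewrite prednK.
  have := eR (D_yu d xi e (Ordinal Hm1)); rewrite y0 mul0r /= => /esym.
  have -> : D_u e (m.-1%:Z + 1) = D_u e 0.
    by rewrite /D_u (_ : m.-1%:Z + 1 = m); [rewrite modzz mod0z | lia].
  rewrite /D_phi (_ : - m.-1%:Z - 1 = - m%:Z); last lia.
  rewrite -exprnN (prim_expr_order gamma_prim) invr1 scale1r mulrBl mul1r.
  by move/subr0_eq => <-; rewrite expr0 scale1r.
have im' : (i < m)%N by apply: ltnW.
have := eR (D_yu d xi e (Ordinal im')); rewrite y0 mul0r /= => /esym.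
rewrite /D_phi (_ : - i%:Z - 1 = - i.+1%:Z); last lia.
rewrite (_ : i%:Z + 1 = i.+1%:Z); last lia.
rewrite -exprnN mulrBl mul1r -scalerAl => /subr0_eq {2}->.
by rewrite scalerA mulfV ?scale1r // expf_neq0.
Qed.

(** The left-hand side is S^2(u_i), computed from
    S(u_i) = c x^E g^F u_i by antimultiplicativity. Moving g^F and x^E across u_i
    turns it into gamma^-i x^((1-m)d) u_i; here (x^d)^m acts as 1 on u_i because
    gamma^m = 1, so that x^((1-m)d) u_i = gamma^i u_i. *)
Lemma D_antipode_square_u (i : nat) : (i < m)%N ->
  let E := ((i * d)%N%:Z + 3 * (((1 - m%:Z) * d%:Z) %/ 2)%Z) in
  let F := (m - i - 1)%N in
  ((-1) ^+ i * xi ^- i * gamma ^- (i * i.+1)./2) ^+ 2 *: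
   (D_xpow e E * g ^+ F * D_u e i * gV ^+ F * D_xpow e (- E)) = D_u e i.
Proof.
move=> im E F.
have xg n : g * D_xpow e n = D_xpow e n * g.
  by apply: (D_xpow_comm eR); rewrite (eR (D_xg _ _ _)).
have g0 : gamma != 0 by rewrite expf_neq0 // xi_neq0.
have gu : g * D_u e i = gamma ^- i *: (D_xpow e (2 * d)%N * D_u e i * g).
  rewrite -mulrA (eR (D_ug d xi e (Ordinal im))) /=.
  have gi : gamma ^+ i != 0 by rewrite expf_neq0.
  rewrite -[x ^+ _]/(D_xpow e (2 * d)%N) -scalerAr scalerA (mulVf gi) scale1r.
  rewrite !mulrA -(D_xpowD eR).
  by rewrite subrr mul1r.
have xgn n j : g ^+ n * D_xpow e j = D_xpow e j * g ^+ n.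
  by apply/esym/commrX; rewrite /GRing.comm xg.
have guF n : g ^+ n * D_u e i * gV ^+ n =
    gamma ^- (i * n) *: (D_xpow e (2 * d * n)%N * D_u e i).
  elim: n => [|n IH]; first by rewrite !muln0 /= !expr0 invr1 scale1r !mul1r mulr1.
  have guV : g * D_u e i * gV = gamma ^- i *: (D_xpow e (2 * d)%N * D_u e i).
    by rewrite gu -scalerAl -!mulrA (eR (D_ggV _ _ _)) mulr1.
  rewrite exprSr exprS !mulrA -[_ * g * _]mulrA -[_ * (_ * _) * gV]mulrA guV.
  rewrite -scalerAr -scalerAl mulrA xgn.
  rewrite -!mulrA [g ^+ n * _]mulrA IH -scalerAr scalerA mulrA -(D_xpowD eR).
  by rewrite -invfM -exprD -PoszD mulnS mulnS.
(* For m = 1 both sides are u_0; otherwise x^(dm) fixes u_i. *)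
have Xmd : D_xpow e (d%:Z * (1 - m%:Z)) * D_u e i = gamma ^+ i *: D_u e i.
  case: (eqVneq m 1%N) => [m1|/eqP m1].
    move: im; rewrite {1}m1 ltnS leqn0 => /eqP ->.
    by rewrite (_ : _ * _ = 0 :> int) ?mul1r ?scale1r //; lia.
  have Xd n : D_xpow e (d * n)%N * D_u e i = gamma ^+ (i * n) *: D_u e i.
    elim: n => [|n IH]; first by rewrite !muln0 /= expr0 scale1r mul1r.
    rewrite mulnS PoszD (D_xpowD eR) -mulrA IH -scalerAr D_xd_u_eigen //.
    by rewrite scalerA mulnS exprD mulrC.
  have Xmd : D_xpow e (d * m)%N * D_u e i = D_u e i.
    by rewrite Xd mulnC exprM (prim_expr_order gamma_prim) expr1n scale1r.
  rewrite -[in LHS]Xmd mulrA -(D_xpowD eR).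
  rewrite (_ : _ + _ = (d * 1)%N%:Z); last by rewrite muln1 PoszM; ring.
  by rewrite Xd muln1.
have q2 : (((1 - m%:Z) * d%:Z) %/ 2)%Z * 2 = (1 - m%:Z) * d%:Z.
  apply/divzK; lia.
have FE : F%:Z = m%:Z - i%:Z - 1 by rewrite /F; lia.
have EF : E + (2 * d * F)%N%:Z + E = d%:Z * (1 - m%:Z).
  rewrite !PoszM FE /E PoszM; move: q2; set q := (_ %/ _)%Z => q2; nia.
have -> : D_xpow e E * g ^+ F * D_u e i * gV ^+ F * D_xpow e (- E) =
    gamma ^- (i * F) *: (gamma ^+ i *: D_u e i).
  rewrite -Xmd -EF -(mulrA (D_xpow e E)) -(mulrA (D_xpow e E)) guF.
  rewrite -scalerAr -scalerAl -!mulrA (D_u_xpow eR) // opprK.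
  by rewrite !mulrA -!(D_xpowD eR).
rewrite !scalerA -[RHS]scale1r; congr (_ *: _).
have g0' n : gamma ^+ n != 0 by rewrite expf_neq0.
have T2 : ((i * i.+1)./2 * 2 = i * i.+1)%N.
  by rewrite muln2 halfK oddM oddS andbN subn0.
rewrite [X in X * _ * _]exprMn [X in X * _ * _ * _]exprMn sqrr_sign mul1r.
have -> : (xi ^- i) ^+ 2 = gamma ^- i by rewrite exprVn -!exprM mulnC.
have -> : (gamma ^- (i * i.+1)./2) ^+ 2 = gamma ^- (i * i.+1).
  by rewrite exprVn -(exprM gamma _ 2) T2.
have : gamma ^+ (i * i.+1) * gamma ^+ (i * F) = 1.
  rewrite -exprD (_ : _ + _ = m * i)%N; last by rewrite /F; nia.
  by rewrite exprM (prim_expr_order gamma_prim) expr1n.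
have := g0' i; have := g0' (i * i.+1)%N; have := g0' (i * F)%N.
move: (gamma ^+ _) (gamma ^+ _) (gamma ^+ _) => a b c a0 b0 c0 bc.
by rewrite -(mulrA a^-1) -invfM bc invr1 mulr1 mulVf.
Qed.
End Calc2.

Section Square.
Context (H : hopfAlgType k) (e : D_gen m -> H).
Hypothesis pe : presents (D_rel d xi (@fgen k (D_gen m))) e.
Hypothesis Sx : antipode (e Dx) = e DxV.
Hypothesis Sg : antipode (e Dg) = e DgV.
Hypothesis Sy : antipode (e Dy) = - (e Dy * e DgV).
Hypothesis Su : forall i : 'I_m, antipode (D_u e i) =
   ((-1) ^+ i * xi ^- i * gamma ^- (i * i.+1)./2) *:
     (D_xpow e ((i * d)%N%:Z + 3 * (((1 - m%:Z) * d%:Z) %/ 2)%Z)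
        * e Dg ^+ (m - i - 1) * D_u e i).

Let eR : D_sat d xi e.
Proof. by apply: (presents_D_sat pe (f := idfun)). Qed.

Let SxV : antipode (e DxV) = e Dx.
Proof. exact: antipode_inv (eR (D_xxV _ _ _)) (eR (D_xVx _ _ _)) Sx. Qed.

Let SgV : antipode (e DgV) = e Dg.
Proof. exact: antipode_inv (eR (D_ggV _ _ _)) (eR (D_gVg _ _ _)) Sg. Qed.

Let SX n : antipode (D_xpow e n) = D_xpow e (- n).
Proof.
case: n => n; rewrite /D_xpow antipodeXn ?Sx ?SxV; first by case: n.
by rewrite NegzE opprK.
Qed.

Lemma D_antipode_square (B : algType k) (f : {lrmorphism H -> B}) :
  m = 1%N \/ f (e Dy) = 0 -> forall a, f (antipode (antipode a)) = f a.
Proof.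
move=> my; pose e' i := f (e i); have fe i : f (e i) = e' i by [].
have e'R := presents_D_sat pe fe.
apply: (presents_ind pe) => [c a b fa fb||a b fa fb|].
- by rewrite !linearP /= fa fb.
- by rewrite !antipode1.
- by rewrite !antipodeM !rmorphM /= fa fb.
case=> [|||||i]; rewrite ?Sx ?SxV ?Sg ?SgV ?Sx ?Sg //.
- rewrite Sy linearN /= antipodeM SgV Sy mulrN opprK.
  case: my => [m1|y0]; last by rewrite !rmorphM /= y0 mul0r mulr0.
  have := prim_expr_order gamma_prim; rewrite {1}m1 expr1 => g1.
  have := eR (D_yg d xi e); rewrite g1 scale1r => gy.
  by rewrite mulrA -gy -mulrA (eR (D_ggV _ _ _)) mulr1.
rewrite -D_uE.
rewrite Su linearZ /= !antipodeM !antipodeXn Sg SX Su.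
rewrite -scalerAl scalerA [LHS]linearZ_LR /= !rmorphM /= !rmorphXn /=.
rewrite !(D_xpow_morph fe) (D_u_morph fe) !fe -[RHS](D_antipode_square_u e'R my (ltn_ord i)).
by rewrite [X in _ = X *: _]expr2 -!mulrA.
Qed.
End Square.
End DAntipode.

(** * Solutions of the relations *)

(** The value at 1 of (X^n - 1) / (X - 1). *)
Lemma prod_1B_root (k : fieldType) n (z : k) : n.-primitive_root z ->
  \prod_(1 <= i < n) (1 - z ^+ i) = n%:R.
Proof.
move=> zn; have n0 := prim_order_gt0 zn.
have := factor_Xn_sub_1 zn; rewrite subrX1 big_ltn // expr0 => E.
have F : ('X - 1 : {poly k}) != 0 by rewrite -polyC1 polyXsubC_eq0.
rewrite polyC1 in E; have /(congr1 (fun p => p.[1])) := mulfI F E.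
rewrite horner_prod horner_sum.
under eq_bigr do rewrite !hornerE.
move=> ->; under eq_bigr do rewrite !hornerE expr1n.
by rewrite sumr_const card_ord.
Qed.

Section DScalar.
Context (k : fieldType) (m : nat) (g : k) (gm : m.-primitive_root g).

(** With g for gamma, the left-hand side is the product of the values of phi_l at
    x^d = g^c, over all residues l but i - 1. Its factor with l = c - 1 vanishes,
    unless this is the excluded residue; then the factors that remain are the
    1 - g^r with 0 < r < m. *)
Lemma phi_prod (i c : nat) : (0 < i <= m)%N ->
  (\prod_(i <= l < m) (1 - g ^ (- l%:Z - 1) * g ^+ c)) *
   (\prod_(0 <= l < i.-1) (1 - g ^ (- l%:Z - 1) * g ^+ c)) =
  if (c == i %[mod m])%N then m%:R else 0.
Proof.
case/andP=> i0 im; have m0 : (0 < m)%N by apply: leq_trans im.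
have gn0 : g != 0.
  apply/negP => /eqP g0; have := prim_expr_order gm.
  by rewrite g0 expr0n gtn_eqF //= => /eqP; rewrite eq_sym oner_eq0.
have gE (l : nat) : g ^ (- l%:Z - 1) * g ^+ c = g ^ (c%:Z - l.+1%:Z).
  by rewrite -[g ^+ c]/(g ^ c%:Z) -expfzDr //; congr (_ ^ _); lia.
case: ifP => [ci|/negP nci].
  rewrite -(prod_1B_root gm) [RHS](big_cat_nat (n := i)) //= [RHS]mulrC.
  have gi (n : int) : g ^ (c%:Z + n) = g ^ (i%:Z + n).
    by rewrite !expfzDr // -!exprnP (eqP (etrans (eq_prim_root_expr gm c i) ci)).
  congr (_ * _).
    rewrite big_nat_rev /= big_nat_cond [RHS]big_nat_cond.
    apply: eq_bigr => l; rewrite andbT => /andP[il li].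
    rewrite gE gi; congr (1 - _).
    transitivity (g ^ (i%:Z - (i + m - l.+1).+1%:Z) * g ^ m%:Z).
      by rewrite -[g ^ m%:Z]/(g ^+ m) (prim_expr_order gm) mulr1.
    by rewrite -expfzDr // exprnP; congr (g ^ _); lia.
  rewrite big_nat_rev /= [RHS]big_add1 big_nat_cond [RHS]big_nat_cond.
  apply: eq_bigr => l; rewrite andbT => /andP[_ li].
  by rewrite gE gi exprnP; congr (1 - g ^ _); lia.
pose l := ((c + m.-1) %% m)%N.
have lm : (l < m)%N by rewrite ltn_mod.
have l1 : (l.+1 = c %[mod m])%N.
  by rewrite -addn1 modnDml -addnA addn1 prednK // modnDr.
have li : l != i.-1.
  apply/negP => /eqP li; apply: nci; rewrite eq_sym; apply/eqP; rewrite -l1 li prednK //.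
have z0 : 1 - g ^ (- l%:Z - 1) * g ^+ c = 0.
  rewrite gE expfzDr // -exprnP -exprnN (eqP (_ : g ^+ c == g ^+ l.+1)).
    by rewrite divff ?subrr // expf_neq0.
  by rewrite (eq_prim_root_expr gm) eq_sym; apply/eqP.
case: (ltngtP l i.-1) li => // li _.
  rewrite [X in _ * X](big_cat_nat (n := l)) ?(ltnW li) //= [X in _ * (_ * X)]big_ltn //.
  by rewrite z0 mul0r !mulr0.
rewrite (big_cat_nat (n := l)) ?(ltnW lm) //=; last lia.
rewrite [X in _ * X * _]big_ltn //.
by rewrite z0 mul0r mulr0 mul0r.
Qed.

End DScalar.

Section DConstruct.
Context (k : fieldType) (m d : nat) (xi : k).
Local Notation gamma := (xi ^+ 2).
Hypothesis m_gt0 : (0 < m)%N.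
Hypothesis xi_prim : (2 * m).-primitive_root xi.

(** For m = 1 one has gamma = 1 and xi = -1, and x and u_0 determine g and y. *)
Lemma D_sat_m1 (B : algType k) (e : D_gen m -> B) :
  m = 1%N ->
  e Dx * e DxV = 1 -> e DxV * e Dx = 1 ->
  e Dg = e Dx ^+ d -> e DgV = e DxV ^+ d -> e Dy = 1 - e Dx ^+ d ->
  (forall i, e Dx * e (Du i) = e (Du i) * e DxV) ->
  (forall i, e (Du i) * e (Du i) = 1) -> D_sat d xi e.
Proof.
move=> m1; move: m1 e m_gt0 xi_prim => -> e _ xip xxV xVx gE gVE yE xu uu.
have xi1 : xi = -1 by rewrite -(xi_m _ xip).
have uE (i : int) : D_u e i = e (Du ord0).
  have i0 : (i %% 1%N)%Z = (0 %% 1%N)%Z by rewrite mod0z; apply: modz1.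
  by rewrite -(D_uE e ord0) /D_u i0.
have phiE (i : int) : D_phi d xi e i = 1 - e Dx ^+ d.
  by rewrite /D_phi xi1 sqrrN expr1n exp1rz scale1r.
have cxV : GRing.comm (e Dx) (e DxV) by rewrite /GRing.comm xxV xVx.
have xxVd : e Dx ^+ d * e DxV ^+ d = 1 by rewrite -exprMn_comm // xxV expr1n.
have xVxd : e DxV ^+ d * e Dx ^+ d = 1 by rewrite -exprMn_comm // xVx expr1n.
have xud : e Dx ^+ d * e (Du ord0) = e (Du ord0) * e DxV ^+ d.
  elim: (d) => [|n IH]; first by rewrite mul1r mulr1.
  by rewrite exprSr -mulrA xu mulrA IH -mulrA -exprSr.
have udx : e (Du ord0) * e Dx ^+ d = e DxV ^+ d * e (Du ord0).
  by rewrite -[LHS]mul1r -xVxd -!mulrA (mulrA _ _ (e Dx ^+ d)) xud -mulrA xVxd mulr1.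
move=> a b [|||||||||i|i|i|i|i j]; rewrite ?uE ?gE ?gVE ?yE ?phiE //.
- exact: commrX.
- by apply: commrB; [apply: commr1 | apply: commrX].
- by rewrite xi1 sqrrN expr1n scale1r mulrBl mulrBr mul1r mulr1.
- by rewrite mul1n expr1.
- by rewrite mul1n expr1.
- by rewrite xi1 scaleN1r mulrBr mulr1 -!mulrA udx (mulrA (_ ^+ d)) xxVd mul1r mulrBl mul1r opprB.
- rewrite (ord1 i) expr0 scale1r D_xpowN mulnC exprM expr2.
  by rewrite -!mulrA (mulrA (e DxV ^+ d) (e Dx ^+ d)) xVxd mul1r udx.
- rewrite (ord1 i) (ord1 j) /D_P /= D_xpowN !expr0 !invr1 !mulr1 !scale1r.
  by rewrite (_ : ((1 + 1) * d)%N./2 = d) ?uu ?xVxd // mul2n doubleK.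
Qed.

(** When y acts as 0, the product P_ij vanishes unless m divides i + j, and
    then it is m times the projector E_i onto the eigenspace of x^d for gamma^i:
    it is the polynomial in x^d that vanishes at every other power of gamma. *)
Lemma D_sat_y0 (B : algType k) (e : D_gen m -> B) (E : nat -> B) :
  (1 < m)%N ->
  e Dx * e DxV = 1 -> e DxV * e Dx = 1 -> e Dg * e DgV = 1 -> e DgV * e Dg = 1 ->
  e Dx * e Dg = e Dg * e Dx -> e Dx ^+ (m * d) = 1 -> e Dg ^+ m = 1 ->
  e Dy = 0 ->
  \sum_(c < m) E c = 1 ->
  (forall c, e Dx ^+ d * E c = gamma ^+ c *: E c) ->
  (forall i, e Dx * e (Du i) = e (Du i) * e DxV) ->
  (forall i, e Dx ^+ d * e (Du i) = gamma ^+ i *: e (Du i)) ->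
  (forall i, e (Du i) * e Dg = gamma ^- i *: (e Dg * e (Du i))) ->
  (forall i j, e (Du i) * e (Du j) = if (m %| i + j)%N then
      ((-1) ^- j * xi ^- j * gamma ^+ (j * j.+1)./2) *:
        (e DxV ^+ (((1 + m) * d)%N./2) * E i * e Dg)
      else 0) ->
  D_sat d xi e.
Proof.
move=> m1 xxV xVx ggV gVg xg xw gm y0 sE xE xu xdu ug uu.
have gp := gamma_prim xi_prim.
have xn0 := xi_neq0 m_gt0 xi_prim.
have g0 n : gamma ^+ n != 0 by rewrite !expf_neq0.
have m0 := prim_root_natf_neq0 gp.
have m10 : (0 < m.-1)%N by rewrite -subn1 subn_gt0.
have phiU (i : 'I_m) : D_phi d xi e i * D_u e (i%:Z + 1) = 0.
  rewrite /D_phi (_ : - i%:Z - 1 = - i.+1%:Z); last lia.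
  have [im|im] := ltnP i.+1 m.
    rewrite (_ : i%:Z + 1 = Ordinal im); last by rewrite /=; lia.
    rewrite D_uE mulrBl mul1r -scalerAl xdu scalerA -exprnN mulVf ?g0 //.
    by rewrite scale1r subrr.
  have im' : i.+1 = m by apply/eqP; rewrite eqn_leq im ltn_ord.
  rewrite (_ : i%:Z + 1 = 0%Z + m); last by rewrite add0r; lia.
  rewrite D_u_addm (D_uE e (Ordinal m_gt0)) mulrBl mul1r -scalerAl xdu.
  by rewrite im' -exprnN (prim_expr_order gp) invr1 expr0 !scale1r subrr.
have prodE a b c : (\prod_(a <= l < b) D_phi d xi e l) * E c =
    (\prod_(a <= l < b) (1 - gamma ^ (- l%:Z - 1) * gamma ^+ c)) *: E c.
  elim/big_rec2: _ => [|l s p _ IH]; first by rewrite mul1r scale1r.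
  rewrite -mulrA IH -scalerAr /D_phi mulrBl mul1r -scalerAl xE scalerA.
  by rewrite -{1}[E c]scale1r -scalerBl scalerA mulrC.
have fullE i : (0 < i <= m)%N ->
    (\prod_(i <= l < m) D_phi d xi e l) * (\prod_(0 <= l < i.-1) D_phi d xi e l)
    = m%:R *: E (i %% m)%N.
  have pE p : p = \sum_(c < m) p * E c by rewrite -mulr_sumr sE mulr1.
  move=> im; rewrite [LHS]pE.
  have im' : (i %% m < m)%N by rewrite ltn_mod.
  rewrite (bigD1 (Ordinal im')) //= [X in _ + X]big1 ?addr0 => [|c].
    by rewrite -mulrA prodE -scalerAr prodE scalerA mulrC phi_prod // modn_mod eqxx.
  rewrite -val_eqE /= => ci.
  rewrite -mulrA prodE -scalerAr prodE scalerA mulrC phi_prod // ifN ?scale0r //.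
  by rewrite modn_small.
have uPE (i j : 'I_m) :
    D_P d xi e i j = if (m %| i + j)%N then m%:R *: E i else 0.
  have [im jm] := (ltn_ord i, ltn_ord j).
  rewrite /D_P; case: ltnP => [ij|ij].
    case: (posnP (i + j)%N) => [ij0|ij0].
      have [-> ->] : i = 0%N :> nat /\ j = 0%N :> nat by lia.
      rewrite addn0 dvdn0 expr0 mulr1 subn0.
      have := @fullE m; rewrite m_gt0 leqnn big_geq // mul1r modnn => -> //.
    by rewrite y0 expr0n gtn_eqF // mulr0 gtnNdvd //; lia.
  case: eqP => ij'.
    by rewrite ij' y0 expr0n gtn_eqF ?gtnNdvd ?prednK ?mulr0n.
  case: (eqVneq (i + j)%N m) => [ijm|ijm].
    rewrite ijm dvdnn subnn expr0 mulr1 (_ : (m.-1 - j)%N = i.-1); last by lia.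
    by rewrite fullE ?modn_small //; lia.
  have mij : (m <= i + j)%N by lia.
  rewrite ifN; last by rewrite -(subnK mij) dvdn_addl // gtnNdvd //; lia.
  by rewrite y0 expr0n gtn_eqF ?mulr0 //; lia.
move=> a b [|||||||||i|i|i|i|i j]; rewrite ?y0 ?xw ?gm ?subrr ?mul0r ?mulr0 //.
- by rewrite scaler0.
- by rewrite expr0n gtn_eqF.
- by rewrite D_uE xu.
- by rewrite phiU scaler0.
- rewrite D_uE D_xpowN.
  have xVud : e DxV ^+ d * e (Du i) = gamma ^- i *: e (Du i).
    have xVxd : e DxV ^+ d * e Dx ^+ d = 1.
      by rewrite -exprMn_comm ?xVx ?expr1n // /GRing.comm xxV xVx.
    by rewrite -[RHS]mul1r -xVxd -mulrA -scalerAr xdu scalerA mulVf ?scale1r ?mulrA.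
  have gu : e Dg * e (Du i) = gamma ^+ i *: (e (Du i) * e Dg).
    by rewrite ug scalerA divff ?scale1r.
  have xVug : e DxV ^+ d * (e (Du i) * e Dg) = gamma ^- i *: (e (Du i) * e Dg).
    by rewrite mulrA xVud scalerAl.
  rewrite -mulrA gu -scalerAr scalerA mulnC exprM [_ ^+ d ^+ 2]expr2 -mulrA.
  rewrite xVug -scalerAr xVug !scalerA -[gamma ^+ i * _ * _ * _]mulrA.
  by rewrite -invfM divff ?scale1r ?mulf_neq0.
- rewrite !D_uE uu uPE D_xpowN; case: ifP => _; last by rewrite mulr0 mul0r scaler0.
  by rewrite -scalerAr -scalerAl scalerA divfK.
Qed.
End DConstruct.

Section Mk2.
Context (k : fieldType).
Implicit Types a b c d : k.

Definition mk2 a b c d : 'M[k]_2 :=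
  \matrix_(i, j) if i == 0 then if j == 0 then a else b
                 else if j == 0 then c else d.

Lemma mk2M a b c d a' b' c' d' : mk2 a b c d * mk2 a' b' c' d' =
  mk2 (a * a' + b * c') (a * b' + b * d') (c * a' + d * c') (c * b' + d * d').
Proof.
apply/matrixP => i j; rewrite !mxE !big_ord_recl big_ord0 addr0 !mxE /=.
by case: (i == 0); case: (j == 0).
Qed.

Lemma mk2D a b c d a' b' c' d' : mk2 a b c d + mk2 a' b' c' d' =
  mk2 (a + a') (b + b') (c + c') (d + d').
Proof. by apply/matrixP => i j; rewrite !mxE; case: (i == 0); case: (j == 0). Qed.

Lemma mk2N a b c d : - mk2 a b c d = mk2 (- a) (- b) (- c) (- d).
Proof. by apply/matrixP => i j; rewrite !mxE; case: (i == 0); case: (j == 0). Qed.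

Lemma mk2Z s a b c d : s *: mk2 a b c d = mk2 (s * a) (s * b) (s * c) (s * d).
Proof. by apply/matrixP => i j; rewrite !mxE; case: (i == 0); case: (j == 0). Qed.

Lemma mk2_1 : 1 = mk2 1 0 0 1.
Proof. by apply/matrixP => -[[|[|?]] ?] [[|[|?]] ?]; rewrite !mxE. Qed.

Lemma mk2_0 : 0 = mk2 0 0 0 0.
Proof. by apply/matrixP => -[[|[|?]] ?] [[|[|?]] ?]; rewrite !mxE. Qed.

Lemma mk2X a d n : mk2 a 0 0 d ^+ n = mk2 (a ^+ n) 0 0 (d ^+ n).
Proof.
elim: n => [|n IH]; first by rewrite !expr0 mk2_1.
by rewrite !exprS IH mk2M !(mulr0, mul0r, addr0, add0r).
Qed.

Lemma mk2_sum I (s : seq I) (P : pred I) (a b c d : I -> k) :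
  \sum_(i <- s | P i) mk2 (a i) (b i) (c i) (d i) =
  mk2 (\sum_(i <- s | P i) a i) (\sum_(i <- s | P i) b i)
      (\sum_(i <- s | P i) c i) (\sum_(i <- s | P i) d i).
Proof.
elim: s => [|i s IH]; first by rewrite !big_nil mk2_0.
by rewrite !big_cons; case: (P i); rewrite IH ?mk2D.
Qed.

End Mk2.

(** * Representations of D(m,d,xi) of dimension 1 and 2 *)

Section DReps.
Context (k : closedFieldType) (m d : nat) (xi : k).
Local Notation gamma := (xi ^+ 2).
Hypothesis m_gt0 : (0 < m)%N.
Hypothesis k0 : [pchar k] =i pred0.
Hypothesis xi_prim : (2 * m).-primitive_root xi.
Context (H : algType k) (e : D_gen m -> H).
Hypothesis pe : presents (D_rel d xi (@fgen k (D_gen m))) e.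

Lemma two_neq0 : 2 != 0 :> k.
Proof. by have /(_ 2%N) := (pcharf0P k).1 k0 => ->. Qed.

Lemma D_char_m1 (s v : k) : m = 1%N -> s ^+ 2 = 1 -> v ^+ 2 = 1 ->
  exists chi : {lrmorphism H -> k^o},
    chi (e Dx) = s /\ (forall i, chi (e (Du i)) = v).
Proof.
move=> m1 s1 v1.
pose e' (i : D_gen m) : k^o := match i with
  | Dx | DxV => s | Dg | DgV => s ^+ d | Dy => 1 - s ^+ d | Du _ => v end.
have /(presents_D_lift pe) [chi chiE] : D_sat d xi e'.
  apply: (D_sat_m1 m_gt0 xi_prim) => //=; rewrite -?expr2 // => i.
  by rewrite mulrC.
by exists chi; split=> *; rewrite chiE.
Qed.

(** With x = 1 the projector E_c is 1 for c = 0 and 0 otherwise, which leaves the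
    equations u_0^2 = g and g^m = 1. *)
Lemma D_char_y0 (v : k) : (1 < m)%N -> v ^+ (2 * m) = 1 ->
  exists chi : {lrmorphism H -> k^o},
    forall i, chi (e (Du i)) = if i == 0%N :> nat then v else 0.
Proof.
move=> m1 vm.
have v0 : v != 0.
  apply/negP => /eqP v0; move: vm; rewrite v0 expr0n.
  by case: (m) m_gt0 => // n _ /eqP; rewrite eq_sym oner_eq0.
have v20 : v ^+ 2 != 0 by rewrite expf_neq0.
pose e' (i : D_gen m) : k^o := match i with
  | Dx | DxV => 1 | Dg => v ^+ 2 | DgV => v ^- 2 | Dy => 0
  | Du i => if i == 0%N :> nat then v else 0 end.
have /(presents_D_lift pe) [chi chiE] : D_sat d xi e'.
  apply: (@D_sat_y0 _ _ d _ m_gt0 xi_prim _ e' (fun c => (c == 0%N)%:R)) => //=.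
  - by rewrite mulr1.
  - by rewrite mulr1.
  - by rewrite divff.
  - by rewrite mulVf.
  - by rewrite mulr1 mul1r.
  - by rewrite expr1n.
  - by rewrite -exprM.
  - by rewrite (bigD1 (Ordinal m_gt0)) //= big1 ?addr0 // => -[[|c] cm]; rewrite -val_eqE.
  - by move=> [|c]; rewrite ?mulr0 ?scaler0 // expr1n expr0 scale1r mulr1.
  - by move=> i; rewrite mul1r mulr1.
  - by move=> [[|i] im]; rewrite ?mulr0 ?scaler0 // expr1n expr0 scale1r mul1r.
  - move=> [[|i] im] /=; rewrite ?mul0r ?mulr0 ?scaler0 //.
    by rewrite expr0 invr1 scale1r mulrC.
  - move=> [[|i] im] [[|j] jm] /=; rewrite ?mulr0 ?mul0r ?scaler0 ?if_same //.
    + by rewrite dvdn0 !expr0 !invr1 !mulr1 expr1n !mul1r scale1r expr2.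
    + by rewrite gtnNdvd.
by exists chi => i; rewrite chiE.
Qed.

(** For m > 1 they send u_0 to 1, -1 and xi; for m = 1 they send (x, u_0) to
    (1, 1), (1, -1) and (-1, 1). *)
Lemma D_three_chars : exists chi1 chi2 chi3 : {lrmorphism H -> k^o},
  exists a b c, [/\ chi1 a != chi2 a, chi1 b != chi3 b & chi2 c != chi3 c].
Proof.
have N1 : (1 : k) != -1 by rewrite -addr_eq0 (_ : 1 + 1 = 2) ?two_neq0.
have [m1|m1] : m = 1%N \/ (1 < m)%N.
  by case: (m) m_gt0 => [|[|]] //; [left | right].
  have one2 : (1 : k) ^+ 2 = 1 by rewrite expr1n.
  have Nsq : (-1 : k) ^+ 2 = 1 by rewrite sqrrN.
  have [c1 [x1 u1]] := D_char_m1 m1 one2 one2.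
  have [c2 [x2 u2]] := D_char_m1 m1 one2 Nsq.
  have [c3 [x3 u3]] := D_char_m1 m1 Nsq one2.
  exists c1, c2, c3, (e (Du (Ordinal m_gt0))), (e Dx), (e Dx).
  by rewrite u1 u2 x1 x2 x3.
have Nm : (-1 : k) ^+ (2 * m) = 1 by rewrite exprM sqrrN !expr1n.
have [c1 u1] := D_char_y0 m1 (expr1n _ _).
have [c2 u2] := D_char_y0 m1 Nm.
have [c3 u3] := D_char_y0 m1 (prim_expr_order xi_prim).
exists c1, c2, c3, (e (Du (Ordinal m_gt0))), (e (Du (Ordinal m_gt0))).
exists (e (Du (Ordinal m_gt0))); rewrite u1 u2 u3 /=.
have xi2 : xi ^+ 2 != 1.
  rewrite -(prim_order_dvd xi_prim) gtnNdvd //; lia.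
split=> //; apply: contraNneq xi2; first by move=> <-; rewrite expr1n.
by move=> <-; rewrite sqrrN expr1n.
Qed.

(** The commutator is (a - a') times an antidiagonal matrix with entries p
    and -1. *)
Lemma diag_antidiag_comm_unit (a a' p : k) : a != a' -> p != 0 ->
  mk2 a 0 0 a' * mk2 0 p 1 0 - mk2 0 p 1 0 * mk2 a 0 0 a' \in GRing.unit.
Proof.
move=> aa' p0.
have aa0 : a - a' != 0 by rewrite subr_eq0.
apply/unitrP; exists (mk2 0 (- (a - a')^-1) ((a - a')^-1 * p^-1) 0).
rewrite !mk2M mk2N mk2D !mk2M mk2_1.
by split; congr mk2; field; rewrite ?aa0 ?p0.
Qed.

Lemma D_rep2_m1 : m = 1%N -> exists rho : {lrmorphism H -> 'M[k]_2},
  exists a b, rho a * rho b - rho b * rho a \in GRing.unit.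
Proof.
move=> m1; have k2 := two_neq0.
pose X := mk2 (2 : k) 0 0 2^-1; pose XV := mk2 2^-1 0 0 (2 : k).
pose U := mk2 (0 : k) 1 1 0.
pose e' (i : D_gen m) : 'M[k]_2 := match i with
  | Dx => X | DxV => XV | Dg => X ^+ d | DgV => XV ^+ d | Dy => 1 - X ^+ d
  | Du _ => U end.
have /(presents_D_lift pe) [rho rhoE] : D_sat d xi e'.
  apply: (D_sat_m1 m_gt0 xi_prim) => //= *; rewrite /X /XV /U.
  1-4: by rewrite !mk2M ?mk2_1 !(mulr0, mul0r, addr0, add0r, mul1r, mulr1) ?mulfV ?mulVf //.
exists rho, (e Dx), (e (Du (Ordinal m_gt0))); rewrite !rhoE /=.
apply: diag_antidiag_comm_unit; rewrite ?oner_eq0 //.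
have k3 : 3 != 0 :> k by have /(_ 3%N) := (pcharf0P k).1 k0 => ->.
apply/negP => /eqP E; have : 2 * 2 = 1 :> k by rewrite {1}E mulVf.
move/eqP; rewrite -subr_eq0 => /negP; apply.
have -> : 2 * 2 - 1 = 3 :> k by ring.
exact: (negP k3).
Qed.

Hypotheses (d_gt0 : (0 < d)%N) (md_even : ~~ odd ((1 + m) * d)).

(** The eigenvalues of x^d are gamma and gamma^-1, so only u_1 and u_(m-1) act by
    nonzero matrices; for m = 2 they are the same generator, which then has both
    antidiagonal entries. *)
Lemma D_rep2_y0 : (1 < m)%N -> exists rho : {lrmorphism H -> 'M[k]_2},
  rho (e Dy) = 0 /\
  exists a b, rho a * rho b - rho b * rho a \in GRing.unit.
Proof.
move=> m1; have gp := gamma_prim xi_prim; have xim := xi_m m_gt0 xi_prim.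
have xn0 := xi_neq0 m_gt0 xi_prim.
have g0 n : gamma ^+ n != 0 by rewrite !expf_neq0.
have [a ad] : exists a : k, a ^+ d = gamma.
  have /closed_rootP [a] : size ('X^d - gamma%:P : {poly k}) != 1.
    by rewrite size_XnsubC // eqSS -lt0n.
  by rewrite rootE !hornerE subr_eq0 => /eqP; exists a.
have a0 : a != 0.
  by apply: contra_eq_neq ad => ->; rewrite expr0n gtn_eqF //= eq_sym -(expr1 gamma).
(* If a^2 = 1 then gamma^2 = 1, so m = 2, hence d is even and
   gamma = a^d = 1. *)
have aV : a != a^-1.
  apply/negP => /eqP aE; have a2 : a ^+ 2 = 1 by rewrite expr2 {2}aE mulfV.
  have : (m %| 2)%N.
    by rewrite (prim_order_dvd gp) -ad -exprM mulnC exprM a2 expr1n.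
  move=> /dvdn_leq m2; have {}m2 : m = 2%N by apply/eqP; rewrite eqn_leq m1 m2.
  have d2 : d = (d./2 * 2)%N.
    by rewrite muln2 even_halfK //; move: md_even; rewrite m2 oddM.
  have : gamma ^+ 1 == 1 by rewrite -ad d2 mulnC exprM a2 !expr1n.
  by rewrite -(prim_order_dvd gp) m2.
pose h := (((1 + m) * d)./2)%N.
have ah : a ^+ h * a ^+ h = gamma.
  rewrite -exprD addnn even_halfK // mulnC exprM ad exprD expr1.
  by rewrite (prim_expr_order gp) mulr1.
(* The relations for u_1 u_(m-1) and u_(m-1) u_1 prescribe the same p,
   because a^(2h) = gamma^(m+1) = gamma. *)
pose p := - xi * a ^- h.
pose e' (i : D_gen m) : 'M[k]_2 := match i with
  | Dx => mk2 a 0 0 a^-1 | DxV => mk2 a^-1 0 0 a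
  | Dg => mk2 1 0 0 gamma^-1 | DgV => mk2 1 0 0 gamma | Dy => 0
  | Du i => mk2 0 (p * (i == 1%N :> nat)%:R) (i == m.-1 :> nat)%:R 0 end.
pose E c := mk2 ((c == 1%N) %:R : k) 0 0 (c == m.-1)%:R.
have gn0 : gamma != 0 := g0 1%N.
have gm1 : gamma ^+ m.-1 = gamma^-1.
  apply: (mulIf (g0 1%N)); rewrite expr1 mulVf ?(g0 1%N) // -exprSr prednK //.
  exact: prim_expr_order gp.
have pE1 : p = -xi * a ^+ h * gamma^-1.
  by rewrite /p -ah -mulrA invfM (mulrA (a ^+ h)) mulfV ?mul1r // expf_neq0.
have cm : (-1) ^- m.-1 * xi ^- m.-1 * gamma ^+ (m.-1 * m)./2 = - xi.
  have -> : gamma ^+ (m.-1 * m)./2 = (-1) ^+ m.-1.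
    rewrite -exprM mulnC muln2 even_halfK; first by rewrite mulnC exprM xim.
    by rewrite -{2}(prednK m_gt0) oddM oddS andbN.
  rewrite mulrAC mulVf ?signr_eq0 // mul1r; apply: (mulIf (expf_neq0 m.-1 xn0)).
  by rewrite mulVf ?expf_neq0 // mulNr -exprS prednK // xim opprK.
have sum1 j : (j < m)%N -> \sum_(c < m) (c == j :> nat)%:R = 1 :> k.
  move=> jm; rewrite (bigD1 (Ordinal jm)) //= eqxx big1 ?addr0 // => c.
  by rewrite -val_eqE /= => /negPf ->.
have m1m : (m.-1 < m)%N by rewrite prednK.
have D1 (j : nat) : (j < m)%N -> (m %| 1 + j)%N -> j = m.-1.
  by move=> jm /dvdn_leq; lia.
have D2 (j : nat) : (j < m)%N -> (m %| m.-1 + j)%N -> j = 1%N.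
  case: j => [|j] jm; first by rewrite addn0 gtnNdvd //; lia.
  rewrite addnS -addSn prednK // dvdn_addr //.
  by case: j jm => // j jm; rewrite gtnNdvd //; lia.
have simp := (mulr0, mul0r, addr0, add0r, mul1r, mulr1).
have /(presents_D_lift pe) [rho rhoE] : D_sat d xi e'.
  apply: (@D_sat_y0 _ _ d _ m_gt0 xi_prim _ e' E) => //=.
  1-4: by rewrite !mk2M ?mk2_1 !simp ?mulfV ?mulVf //.
  - by rewrite !mk2M !simp [a^-1 * _]mulrC.
  - rewrite mk2X exprVn mulnC exprM ad.
    by rewrite (prim_expr_order gp) invr1 mk2_1.
  - by rewrite mk2X expr1n exprVn (prim_expr_order gp) invr1 mk2_1.
  - by rewrite mk2_sum !sum1 // !big1 // mk2_1.
  - move=> c; rewrite mk2X mk2M mk2Z !simp exprVn ad; congr mk2.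
      by case: eqVneq => [->|_]; rewrite ?expr1 // !simp.
    by case: eqVneq => [->|_]; rewrite ?gm1 // !simp.
  - by move=> i; rewrite !mk2M !simp; congr mk2; rewrite mulrC.
  - move=> i; rewrite mk2X mk2M mk2Z !simp exprVn ad; congr mk2.
      by case: eqVneq => [->|_]; rewrite ?expr1 // !simp.
    by case: eqVneq => [->|_]; rewrite ?gm1 // !simp.
  - move=> i; rewrite !mk2M mk2Z !simp; congr mk2.
      by case: eqVneq => [->|_]; rewrite ?expr1 1?mulrC // !simp.
    by case: eqVneq => [->|_]; rewrite ?gm1 ?invrK ?simp ?mulfV ?mulr0.
  - move=> i j; rewrite mk2M mk2X !simp.
    case: ifP => [D|/negbT D]; [rewrite !mk2M mk2Z !simp | rewrite mk2_0]; congr mk2.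
    + case: (eqVneq (i : nat) 1%N) D => [->|_ _]; last by rewrite !simp.
      move=> /(D1 _ (ltn_ord j)) ->; rewrite eqxx prednK // cm /p exprVn.
      by rewrite !simp.
    + case: (eqVneq (i : nat) m.-1) D => [->|_ _]; last by rewrite !simp.
      move=> /(D2 _ (ltn_ord j)) ->; rewrite !simp -[(1 * 2)./2%N]/1%N.
      rewrite pE1 mulrA expr1; congr (_ * _ / _).
      by rewrite expr1 invrN1 mulN1r mulNr expr2 mulKf.
    + case: (eqVneq (i : nat) 1%N) D => [->|_ _]; last by rewrite !simp.
      case: (eqVneq (j : nat) m.-1) => [->|]; last by rewrite !simp.
      by rewrite add1n prednK // dvdnn.
    + case: (eqVneq (i : nat) m.-1) D => [->|_ _]; last by rewrite !simp.
      case: (eqVneq (j : nat) 1%N) => [->|]; last by rewrite !simp.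
      by rewrite addn1 prednK // dvdnn.
exists rho; split; first by rewrite rhoE.
exists (e Dx), (\sum_i e (Du i)); rewrite raddf_sum /= rhoE.
under [\sum_i _]eq_bigr do rewrite rhoE /=.
have -> : \sum_(i < m) mk2 0 (p * (i == 1%N :> nat)%:R) (i == m.-1 :> nat)%:R 0 =
    mk2 0 p 1 0.
  by rewrite mk2_sum -mulr_sumr !sum1 // mulr1 !big1.
apply: diag_antidiag_comm_unit => //; rewrite /p mulf_neq0 ?oppr_eq0 ?invr_eq0 ?expf_neq0 //.
Qed.
End DReps.

(** * Transport along isomorphisms, and the other Hopf algebras *)

Lemma hopf_iso_sym (k : fieldType) (H K : hopfAlgType k) :
  hopf_iso H K -> hopf_iso K H.
Proof.
case=> f [[g fK gK] fD fe fS].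
have gl : linear g.
  by move=> c a b; apply: (can_inj fK); rewrite linearP /= !gK.
have gm : monoid_morphism g.
  split=> [|a b]; apply: (can_inj fK); first by rewrite rmorph1 gK.
  by rewrite rmorphM /= !gK.
pose gL := GRing.isLinear.Build k K H *:%R g gl.
pose gM := GRing.isMonoidMorphism.Build K H g gm.
pose g' : {lrmorphism K -> H} := HB.pack g gL gM.
exists g'; have fl : linear f by apply: linearP.
split; first by exists f.
- move=> a; rewrite -{2}(gK a) fD /tmap tlift_tmap //; last first.
    by apply: bilin_comp => //; apply: tens_bilin.
  rewrite tlift_terms => [|w c v v' /=].
    rewrite {1}[comul (g' a)]tensor_termsK; apply: eq_bigr => p _.
    by rewrite /= !fK.
  by rewrite !fK tens_linl.
- by move=> a; rewrite -{2}(gK a) fe.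
- by move=> a; rewrite -{2}(gK a) fS /= fK.
Qed.

Section Rep2.
Context (k : fieldType) (A : algType k) (psi : {lrmorphism A -> 'M[k]_2}).
Hypothesis psi_nc : exists a b, psi a * psi b - psi b * psi a \in GRing.unit.

Lemma rep_ncomm : ~ (forall a b, psi a * psi b = psi b * psi a).
Proof. by move=> C; case: psi_nc => a [b]; rewrite C subrr unitr0. Qed.

Lemma rep_no_eigen (v : 'rV[k]_2) : v != 0 ->
  ~ (forall a, exists c, v *m psi a = c *: v).
Proof.
move=> v0 ev; case: psi_nc => a [b] uC; move/eqP: v0; apply.
have [s sE] := ev a; have [t tE] := ev b.
have : v *m (psi a * psi b - psi b * psi a) = 0.
  by rewrite mulmxBr !mulmxA sE tE -!scalemxAl sE tE !scalerA mulrC subrr.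
move=> v0; rewrite -[v]mulmx1 -[1%:M]/(1 : 'M[k]_2) -(divrr uC) -[_ / _]/(_ *m _) mulmxA v0.
by rewrite mul0mx.
Qed.

Context (I : choiceType) (R : {malg k[{fmonom I}]} -> {malg k[{fmonom I}]} -> Prop).
Context (e : I -> A) (pe : presents R e).

(** Two nested inductions on generation: an element that commutes with all
    generators commutes with everything. *)
Lemma rep_gen_ncomm :
  ~ (forall i j, psi (e i) * psi (e j) = psi (e j) * psi (e i)).
Proof.
move=> C; apply: rep_ncomm => a.
apply: (presents_ind pe) => [c b b' Cb Cb'||b b' Cb Cb'|i].
- by rewrite !linearP /= mulrDr mulrDl -scalerAr -scalerAl Cb Cb'.
- by rewrite !rmorph1 mulr1 mul1r.
- by rewrite !rmorphM /= mulrA Cb -!mulrA Cb'.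
move: a; apply: (presents_ind pe) => [c b b' Cb Cb'||b b' Cb Cb'|//].
- by rewrite !linearP /= mulrDr mulrDl -scalerAr -scalerAl Cb Cb'.
- by rewrite !rmorph1 mulr1 mul1r.
- by rewrite !rmorphM /= -mulrA Cb' !mulrA Cb.
Qed.

Lemma rep_gen_no_eigen (v : 'rV[k]_2) : v != 0 ->
  ~ (forall i, exists c, v *m psi (e i) = c *: v).
Proof.
move=> v0 ev; apply: (rep_no_eigen v0).
apply: (presents_ind pe) => [c a b [s sE] [t tE]||a b [s sE] [t tE]|//].
- exists (c * s + t); rewrite linearP /= mulmxDr -scalemxAr sE tE.
  by rewrite scalerDl scalerA.
- by exists 1; rewrite rmorph1 mulmx1 scale1r.
- exists (s * t); rewrite rmorphM /= mulmxA sE -scalemxAl tE.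
  by rewrite scalerA.
Qed.

End Rep2.

Section Relations.
Context (k : fieldType) (A : algType k).

Section Abstract.
Context (F : lalgType k) (f : {lrmorphism F -> A}).

Lemma laurent_relations_in (u : laurent_gen -> F) (e : laurent_gen -> A) :
  (forall i, f (u i) = e i) -> (forall a b, laurent_rel u a b -> f a = f b) ->
  e Lau_x * e Lau_xV = 1 /\ e Lau_xV * e Lau_x = 1.
Proof.
move=> fE fR; rewrite -!fE -!rmorphM -(rmorph1 f).
by split; apply: fR; constructor.
Qed.

Lemma taft_relations_in n eta (u : taft_gen -> F) (e : taft_gen -> A) :
  (forall i, f (u i) = e i) -> (forall a b, taft_rel n eta u a b -> f a = f b) ->
  e Taft_g ^+ n = 1 /\ e Taft_x * e Taft_g = eta *: (e Taft_g * e Taft_x).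
Proof.
move=> fE fR; rewrite -!fE -!rmorphM -rmorphXn -(rmorph1 f) -(linearZ_LR f).
by split; apply: fR; constructor.
Qed.

Lemma liu_relations_in n w gamma (u : liu_gen -> F) (e : liu_gen -> A) :
  (forall i, f (u i) = e i) -> (forall a b, liu_rel n w gamma u a b -> f a = f b) ->
  [/\ e Liu_x * e Liu_xV = 1, e Liu_xV * e Liu_x = 1,
      e Liu_x * e Liu_g = e Liu_g * e Liu_x &
      e Liu_x * e Liu_y = e Liu_y * e Liu_x].
Proof.
move=> fE fR; rewrite -!fE -!rmorphM -(rmorph1 f).
by split; apply: fR; constructor.
Qed.

End Abstract.

Lemma laurent_relations (e : laurent_gen -> A) :
  presents (laurent_rel (@fgen k laurent_gen)) e ->
  e Lau_x * e Lau_xV = 1 /\ e Lau_xV * e Lau_x = 1.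
Proof. by move=> pe; apply: laurent_relations_in (eval_gen e) (presents_rel pe). Qed.

Lemma taft_relations n eta (e : taft_gen -> A) :
  presents (taft_rel n eta (@fgen k taft_gen)) e ->
  e Taft_g ^+ n = 1 /\ e Taft_x * e Taft_g = eta *: (e Taft_g * e Taft_x).
Proof. by move=> pe; apply: taft_relations_in (eval_gen e) (presents_rel pe). Qed.

Lemma liu_relations n w gamma (e : liu_gen -> A) :
  presents (liu_rel n w gamma (@fgen k liu_gen)) e ->
  [/\ e Liu_x * e Liu_xV = 1, e Liu_xV * e Liu_x = 1,
      e Liu_x * e Liu_g = e Liu_g * e Liu_x &
      e Liu_x * e Liu_y = e Liu_y * e Liu_x].
Proof. by move=> pe; apply: liu_relations_in (eval_gen e) (presents_rel pe). Qed.

End Relations.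

Lemma linear_eq_mlift (k : fieldType) (X : choiceType) (V W : lmodType k)
    (e : X -> V) (f g : V -> W) s : linear f -> linear g ->
  (forall x, f (e x) = g (e x)) -> f (mlift e s) = g (mlift e s).
Proof.
move=> fl gl fg; rewrite /mlift (linear_map_sum _ _ fl) (linear_map_sum _ _ gl).
by apply: eq_bigr => x _; rewrite (linear_mapZ fl) (linear_mapZ gl) fg.
Qed.

Section CharSquare.
Context (k : fieldType) (H : hopfAlgType k).
Implicit Type chi : {lrmorphism H -> k^o}.

(** The square of a character for the convolution product. *)
Definition char_square chi (a : H) : k :=
  tlift (fun b c => (chi b : k^o) * chi c) (comul a).

Lemma char_square_bilin chi : bilin (fun b c => (chi b : k^o) * chi c).
Proof.
split=> z c u v; first by rewrite linearP /= mulrDl scalerAl.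
by rewrite linearP /= mulrDr scalerAr.
Qed.

Lemma char_square_linear chi : linear (char_square chi : H -> k^o).
Proof.
move=> c a b; rewrite /char_square comul_is_linear.
exact: (tlift_linear (char_square_bilin chi)).
Qed.

Lemma char_square_comp (K : hopfAlgType k) (f : {lrmorphism K -> H}) chi b :
  comul (f b) = tmap f f (comul b) ->
  char_square chi (f b) =
  tlift (fun u v => (chi (f u) : k^o) * chi (f v)) (comul b).
Proof.
move=> fD; have fl : linear f by apply: linearP.
by rewrite /char_square fD (tlift_tmap _ fl fl (char_square_bilin chi)).
Qed.

End CharSquare.

(** Only the summand with index 0 of the coproduct of u_0 contributes. *)
Lemma D_char_square (k : fieldType) (m d : nat) (c : nat -> k) (m_gt0 : (0 < m)%N)
    (H : hopfAlgType k) (e : D_gen m -> H) (chi : {lrmorphism H -> k^o}) :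
  c 0%N = 1 ->
  comul (D_u e 0) = \sum_(j < m) c j *:
    (D_u e j *t (D_xpow e (- (j * d)%N%:Z) * e Dg ^+ j * D_u e (0 - j%:Z))) ->
  (forall i : 'I_m, i != 0%N :> nat -> chi (e (Du i)) = 0) ->
  char_square chi (D_u e 0) = chi (e (Du (Ordinal m_gt0))) ^+ 2.
Proof.
move=> c0 cu chiu; have bl := char_square_bilin chi.
rewrite /char_square cu (linear_map_sum _ _ (tlift_linear bl)).
rewrite (bigD1 (Ordinal m_gt0)) //= big1 ?addr0 => [|j j0]; last first.
  rewrite (linear_mapZ (tlift_linear bl)) tlift_tensE // D_uE chiu ?mul0r ?scaler0 //.
have -> : D_xpow e (- (Ordinal m_gt0 * d)%N%:Z) * e Dg ^+ Ordinal m_gt0 *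
    D_u e (0 - (Ordinal m_gt0)%:Z) = e (Du (Ordinal m_gt0)).
  by rewrite /= !expr0 !mul1r; exact: (D_uE e (Ordinal m_gt0)).
rewrite (linear_mapZ (tlift_linear bl)) tlift_tensE // c0 scale1r.
by rewrite (D_uE e (Ordinal m_gt0)).
Qed.

Section Others.
Context (k : fieldType) (K : hopfAlgType k).

Section TwoDim.
Context (psi : {lrmorphism K -> 'M[k]_2}).
Hypothesis psi_nc : exists a b, psi a * psi b - psi b * psi a \in GRing.unit.

Lemma polynomial_no_rep2 : ~ is_polynomial_hopf K.
Proof.
case=> f [[g fK gK] _]; apply: (rep_ncomm psi_nc) => a b.
by rewrite -!rmorphM -(gK a) -(gK b) -!rmorphM mulrC.
Qed.

Lemma laurent_no_rep2 : ~ is_laurent_hopf K.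
Proof.
case=> e [pe _]; apply: (rep_gen_ncomm psi_nc pe).
have [xxV xVx] := laurent_relations pe.
by move=> [] [] //; rewrite -!rmorphM xVx xxV.
Qed.

Lemma liu_no_rep2 n w gamma : (forall a, psi (antipode (antipode a)) = psi a) ->
  ~ is_liu n w gamma K.
Proof.
move=> psiS [e [pe _ [_ _ [gSg Sgg]] _ [_ Sy]]].
have gm := antipode_inv gSg Sgg erefl.
have SSy := psiS (e Liu_y).
rewrite Sy linearN /= antipodeM Sy mulrN opprK gm in SSy.
have yg : psi (e Liu_y) * psi (e Liu_g) = psi (e Liu_g) * psi (e Liu_y).
  by rewrite -{1}SSy -rmorphM -!mulrA Sgg mulr1 rmorphM.
have [xxV xVx xg xy] := liu_relations pe.
have xVg := comm_inv xxV xVx (esym xg); have xVy := comm_inv xxV xVx (esym xy).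
apply: (rep_gen_ncomm psi_nc pe) => -[] [] //; rewrite ?yg // -!rmorphM.
all: by rewrite ?xxV ?xVx ?xg ?xy ?xVg ?xVy.
Qed.

Lemma taft_no_rep2 n t eta : n.-primitive_root eta -> (2 < n)%N ->
  ~ is_taft n t eta K.
Proof.
move=> en n2 [e [pe _ _ _ _]].
have [gn xg] := taft_relations pe.
have Gn : psi (e Taft_g) ^+ n = 1 by rewrite -rmorphXn gn rmorph1.
have TG : psi (e Taft_x) * psi (e Taft_g) =
    eta *: (psi (e Taft_g) * psi (e Taft_x)).
  by rewrite -rmorphM xg -rmorphM -[RHS](linearZ_LR psi).
move: TG Gn.
set T := psi (e Taft_x); set G := psi (e Taft_g) => TG Gn.
have [T0|T0] := eqVneq T 0.
  by apply: (rep_gen_ncomm psi_nc pe) => -[] [] //; rewrite -/T T0 mulr0 mul0r.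
have detG : \det G != 0.
  apply/negP => /eqP G0; have := det1 k 2; rewrite -[1%:M]/(1 : 'M[k]_2) -Gn.
  case: (n) n2 => // p _; rewrite exprS -[_ * _]/(_ *m _) det_mulmx G0 mul0r.
  by move/eqP; rewrite eq_sym oner_eq0.
(* Determinants of 2 x 2 matrices give eta^2 det(T) det(G) = det(T) det(G). *)
have detT : \det T == 0.
  have := congr1 determinant (TG : T *m G = eta *: (G *m T)).
  rewrite detZ !det_mulmx [\det G * _]mulrC => E.
  have : (1 - eta ^+ 2) * (\det T * \det G) == 0 by rewrite mulrBl mul1r -E subrr.
  rewrite !mulf_eq0 (negPf detG) orbF subr_eq0 eq_sym.
  by rewrite -(prim_order_dvd en) gtnNdvd.
have [v v0 vT] := det0P detT.
have eta0 : eta != 0.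
  apply/negP => /eqP e0; have := prim_expr_order en.
  by rewrite e0 expr0n gtn_eqF ?(prim_order_gt0 en) // => /eqP; rewrite eq_sym oner_eq0.
have vGT : v *m G *m T = 0.
  have := congr1 (mulmx v) (TG : T *m G = eta *: (G *m T)).
  rewrite mulmxA vT mul0mx -scalemxAr mulmxA.
  by move=> /esym/eqP; rewrite scalemx_eq0 (negPf eta0) => /eqP.
(* T kills v and v G; as T != 0 they are proportional. *)
have : \det (col_mx v (v *m G)) == 0.
  apply/negPn/negP => dM; move/eqP: T0; apply.
  have uM : col_mx v (v *m G) \in unitmx by rewrite unitmxE unitfE.
  by rewrite -[T](mulKmx uM) mul_col_mx vT vGT col_mx0 mulmx0.
case/det0P => w w0; rewrite -[w]hsubmxK mul_row_col.
set w1 := lsubmx w; set w2 := rsubmx w => wE.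
apply: (rep_gen_no_eigen psi_nc pe v0) => -[]; first by exists 0; rewrite vT scale0r.
move: wE; rewrite [w1]mx11_scalar [w2]mx11_scalar !mul_scalar_mx => wE.
have w20 : w2 0 0 != 0.
  apply/negP => /eqP w20; move: wE; rewrite w20 scale0r addr0 => /eqP.
  rewrite scalemx_eq0 (negPf v0) orbF => /eqP w10; move/eqP: w0; apply.
  rewrite -[w]hsubmxK -/w1 -/w2 [w1]mx11_scalar [w2]mx11_scalar w10 w20.
  by rewrite -scalemx1 scale0r row_mx0.
exists (- (w2 0 0)^-1 * w1 0 0); apply: (scalerI w20).
rewrite scalerA mulrA mulrN divff // mulN1r scaleNr.
by apply/eqP; rewrite -addr_eq0 addrC wE.
Qed.

End TwoDim.

Lemma taft2_two_chars t eta (chi1 chi2 chi3 : {lrmorphism K -> k^o}) :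
  2.-primitive_root eta -> 2 != 0 :> k -> is_taft 2 t eta K ->
  [\/ chi1 =1 chi2, chi1 =1 chi3 | chi2 =1 chi3].
Proof.
move=> e2 k2 [e [pe _ _ _ _]].
have eta1 : eta = -1.
  have := prim_expr_order e2 => /eqP; rewrite sqrf_eq1 => /orP[/eqP E|/eqP //].
  by have := prim_order_dvd e2 1; rewrite expr1 E eqxx.
have [gg xg] := taft_relations pe; rewrite eta1 scaleN1r in xg.
have chiP (chi : {lrmorphism K -> k^o}) :
    chi (e Taft_x) = 0 /\ (chi (e Taft_g) = 1 \/ chi (e Taft_g) = -1).
  have : (chi (e Taft_g) : k) ^+ 2 == 1.
    by have /(congr1 chi) := gg; rewrite rmorphXn rmorph1 /= => ->.
  rewrite sqrf_eq1 => gE; split; last by case/orP: gE => /eqP; [left|right].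
  have /(congr1 chi) := xg; rewrite rmorphN !rmorphM /=.
  rewrite mulrC => /eqP; rewrite -addr_eq0 -mulr2n -mulr_natr !mulf_eq0.
  rewrite (negPf k2) orbF => /orP[/eqP g0|/eqP //].
  by move: gE; rewrite g0 eq_sym oner_eq0 eq_sym oppr_eq0 oner_eq0.
have eqchi (c c' : {lrmorphism K -> k^o}) :
    c (e Taft_g) = c' (e Taft_g) -> c =1 c'.
  move=> E; apply: (presents_eq_on pe) => -[] //.
  by rewrite (chiP c).1 (chiP c').1.
have [_ g1] := chiP chi1; have [_ g2] := chiP chi2; have [_ g3] := chiP chi3.
by case: g1 g2 g3 => g1 [] g2 [] g3;
  (by constructor 1; apply: eqchi; rewrite g1 g2) ||
  (by constructor 2; apply: eqchi; rewrite g1 g3) ||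
  (by constructor 3; apply: eqchi; rewrite g2 g3).
Qed.

Lemma dihedral_char_square (G : groupType) (chi : {lrmorphism K -> k^o}) a :
  is_infinite_dihedral G -> is_group_algebra G K ->
  char_square chi a = counit a.
Proof.
move=> [e1 [e1s e1r]] [e [[ei eK Ke] e_1 eM eD]].
pose E z : k := chi (e z).
have EM x y : E (x * y)%g = E x * E y by rewrite /E eM rmorphM.
have E1 : E 1%g = 1 by rewrite /E e_1 rmorph1.
have EV x : E x * E x^-1%g = 1 by rewrite -EM mulgV E1.
have rel r s : dihedral_rel r s -> weval e1 r = weval e1 s.
  move=> rs; apply/e1r; rewrite -[r]cats0 -[s]cats0.
  exact: (WordEquiv_rel [::] [::] rs).
have gg : E (e1 Dih_g) * E (e1 Dih_g) = 1.
  have := congr1 E (rel _ _ Dih_gg).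
  by rewrite /weval !big_cons big_nil /= mulg1 EM E1.
have xx : E (e1 Dih_x) * E (e1 Dih_x) = 1.
  have := congr1 E (rel _ _ Dih_gxg).
  rewrite /weval !big_cons !big_nil /= !mulg1 !EM.
  move=> gxg; rewrite -(EV (e1 Dih_x)) -gxg.
  by rewrite (mulrCA (E (e1 Dih_g))) gg mulr1.
have sq z : E z * E z = 1.
  have [w <-] := e1s z; rewrite /weval.
  elim: w => [|[i b] w IH]; first by rewrite big_nil E1 mulr1.
  rewrite big_cons EM mulrACA IH mulr1.
  have ii : E (e1 i) * E (e1 i) = 1 by case: i.
  case: b => //=; rewrite -[LHS]mul1r -{1}ii mulrACA.
  by rewrite !EV mulr1.
rewrite -(Ke a); set s := ei a.
apply: (@linear_eq_mlift k G K k^o e (char_square chi) counit) => [|c u v|x].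
- exact: char_square_linear.
- exact: (@counit_is_scalar k K c u v).
have [eD1 -> _] := eD x.
rewrite /char_square eD1 tlift_tensE //; last exact: char_square_bilin.
exact: sq.
Qed.

End Others.

(* For m = 1 one has D(1, d, -1) = k<x^{+-1}, u_0 | u_0^2 = 1, x u_0 = u_0 x^-1>
   with x and u_0 group-like, which is the group algebra of the infinite
   dihedral group: the comparison with that algebra needs 1 < m. *)
Theorem corollary4p10 (k : closedFieldType) (m d : nat) (xi : k)
    (H : hopfAlgType k) :
  [pchar k] =i pred0 -> (0 < m)%N -> (0 < d)%N -> ~~ odd ((1 + m) * d) ->
  (2 * m).-primitive_root xi -> is_D m d xi H ->
  [/\ forall K : hopfAlgType k, is_polynomial_hopf K -> ~ hopf_iso H K,
      forall K : hopfAlgType k, is_laurent_hopf K -> ~ hopf_iso H K,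
      (1 < m)%N ->
        forall (G : groupType) (K : hopfAlgType k),
          is_infinite_dihedral G -> is_group_algebra G K -> ~ hopf_iso H K,
      forall (n t : nat) (eta : k) (K : hopfAlgType k),
        (1 < n)%N -> (t <= n - 1)%N -> n.-primitive_root eta ->
        is_taft n t eta K -> ~ hopf_iso H K
    & forall (n w : nat) (gamma : k) (K : hopfAlgType k),
        (0 < n)%N -> (0 < w)%N -> n.-primitive_root gamma ->
        is_liu n w gamma K -> ~ hopf_iso H K].
Proof.
move=> k0 m_gt0 d_gt0 md_even xi_prim.
case=> e [pe [_ _ Sx] [_ _ Sg] [_ _ Sy] Hu].
have m1P : m = 1%N \/ (1 < m)%N by case: (m) m_gt0 => [|[|]] //; [left | right].
have k2 := two_neq0 k0.
have [rho rho_nc rhoS] : exists2 rho : {lrmorphism H -> 'M[k]_2},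
    exists a b, rho a * rho b - rho b * rho a \in GRing.unit
  & forall a, rho (antipode (antipode a)) = rho a.
  have S2 := D_antipode_square m_gt0 xi_prim md_even pe Sx Sg Sy
    (fun i => let: And3 _ _ h := Hu i in h).
  case: m1P => [m1|m1].
    have [rho rho_nc] := D_rep2_m1 m_gt0 k0 xi_prim pe m1.
    by exists rho => // a; apply: S2; left.
  have [rho [rho_y rho_nc]] := D_rep2_y0 m_gt0 xi_prim pe d_gt0 md_even m1.
  by exists rho => // a; apply: S2; right.
have transport (K : hopfAlgType k) : hopf_iso H K ->
    exists psi : {lrmorphism K -> 'M[k]_2},
    (exists a b, psi a * psi b - psi b * psi a \in GRing.unit) /\
    forall a, psi (antipode (antipode a)) = psi a.
  move=> /hopf_iso_sym [f [[g fK gK] _ _ fS]]; exists (rho \o f); split.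
    by have [a [b ab]] := rho_nc; exists (g a), (g b); rewrite /= !gK.
  by move=> a; rewrite /= -!fS rhoS.
split.
- by move=> K Kpoly /transport [psi [nc _]]; exact: (polynomial_no_rep2 nc Kpoly).
- by move=> K Klau /transport [psi [nc _]]; exact: (laurent_no_rep2 nc Klau).
- move=> m1 G K Gdih KG /hopf_iso_sym [f [[g fK gK] fD fe _]].
  have [chi chiu] := D_char_y0 m_gt0 xi_prim pe m1 (prim_expr_order xi_prim).
  have [cu eu _] := Hu (Ordinal m_gt0).
  have := dihedral_char_square (chi \o f) (g (D_u e 0)) Gdih KG.
  rewrite -[LHS](char_square_comp chi (fD _)) -fe gK eu.
  pose c (j : nat) : k := xi ^+ 2 ^ (j%:Z * (0 - j%:Z)).
  rewrite (@D_char_square _ _ _ c m_gt0 _ _ chi _ cu) ?chiu // => [/eqP|i i0].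
    rewrite -(prim_order_dvd xi_prim) => /dvdn_leq; lia.
  by rewrite chiu (negPf i0).
- move=> n t eta K n1 _ eta_prim Kt isoHK.
  have [psi [nc _]] := transport K isoHK.
  have [n2|n2] := ltnP 2 n; first exact: (taft_no_rep2 nc eta_prim n2 Kt).
  have nE : n = 2%N by apply/eqP; rewrite eqn_leq n1 n2.
  move: isoHK => /hopf_iso_sym [f [[g fK gK] _ _ _]].
  have distinct (chi chi' : {lrmorphism H -> k^o}) a : chi a != chi' a ->
    ~ (chi \o f : {lrmorphism K -> k^o}) =1 (chi' \o f : {lrmorphism K -> k^o}).
    by move=> /eqP ca E; apply: ca; have := E (g a); rewrite /= gK.
  have [chi1 [chi2 [chi3 [a [b [c [d12 d13 d23]]]]]]] :=
    D_three_chars m_gt0 k0 xi_prim pe.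
  subst n.
  have := taft2_two_chars (chi1 \o f) (chi2 \o f) (chi3 \o f) eta_prim k2 Kt.
  by case; apply: distinct; eassumption.
- move=> n w gamma K _ _ _ Kliu /transport [psi [nc psiS]].
  exact: (liu_no_rep2 nc psiS Kliu).
Qed.
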